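(* Let $d$ be a fixed even positive integer. Then, as $n\to\infty$, $$1-\frac{1}{d-1}+o(1)\ \leq\ \frac{\mathrm{fmax}(d,n;1)}{\binom{n}{2}}\ \leq\ 1-\frac{1}{2^d}+o(1).$$
   Context: A polytope $P\subset\mathbb{R}^d$ (convex hull of finitely many points) is centrally symmetric if $P=-P$. $\mathrm{fmax}(d,n;j)$ denotes the maximum number of $j$-dimensional faces of a centrally symmetric $d$-dimensional polytope with $n$ vertices; it is defined for those $n$ for which such polytopes exist (in particular $n$ is even), and the asymptotics are as $n\to\infty$ over such $n$. *)

(* Defs.v *)
From HB Require Import structures.
From mathcomp Require Export all_boot all_order all_algebra finmap.
From mathcomp Require Export all_classical all_reals all_analysis.
Export Order.TTheory GRing.Theory Num.Theory.
Export numFieldNormedType.Exports.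

#[export] Set Implicit Arguments.
#[export] Unset Strict Implicit.
#[export] Unset Printing Implicit Defensive.

Local Open Scope classical_set_scope.
Local Open Scope ring_scope.

Definition convex_hull (R : realType) (d : nat) (A : set 'rV[R]_d)
    : set 'rV[R]_d :=
  smallest (@convex_set R 'rV[R]_d) A.

Definition affine_hull (R : realType) (d : nat) (A : set 'rV[R]_d)
    : set 'rV[R]_d :=
  [set p | exists (k : nat) (x : 'I_k -> 'rV[R]_d) (w : 'I_k -> R),
      [/\ forall i, A (x i), \sum_i w i = 1 & p = \sum_i w i *: x i]].

(* The affine hull of [A] is a translate of a [j]-dimensional subspace; no [j]
   satisfies this for [A] empty (whose dimension is conventionally -1). *)
Definition has_dim (R : realType) (d : nat) (A : set 'rV[R]_d) (j : nat)
    : Prop :=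
  exists (x0 : 'rV[R]_d) (U : {vspace 'rV[R]_d}),
    affine_hull A = [set x0 + u | u in [set` U]] /\ \dim U = j.

Definition polytope (R : realType) (d : nat) (P : set 'rV[R]_d) : Prop :=
  exists2 A : set 'rV[R]_d, finite_set A & P = convex_hull A.

(* [F] is cut out of [P] by a linear inequality [<c, x> <= m] valid on [P].
   Taking [c = 0] gives the improper faces [P] and [set0]. *)
Definition face (R : realType) (d : nat) (P F : set 'rV[R]_d) : Prop :=
  exists (c : 'rV[R]_d) (m : R),
    (forall x, P x -> \sum_i c ord0 i * x ord0 i <= m) /\
    F = [set x | P x /\ \sum_i c ord0 i * x ord0 i = m].

(* [fset_set] is empty on infinite sets, but a polytope has finitely many
   faces. *)
Definition num_faces (R : realType) (d : nat) (P : set 'rV[R]_d) (j : nat)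
    : nat :=
  #|` fset_set [set F : set 'rV[R]_d | face P F /\ has_dim F j] |.

Definition centrally_symmetric (R : realType) (d : nat) (P : set 'rV[R]_d)
    : Prop :=
  P = [set - x | x in P].

(* The vertices are counted as the 0-dimensional faces. *)
Definition cs_polytope (R : realType) (d n : nat) (P : set 'rV[R]_d) : Prop :=
  [/\ polytope P, centrally_symmetric P, has_dim P d & num_faces P 0 = n].

(* The maximum is attained whenever some [P] satisfies [cs_polytope n P]; the
   default value 0 is only used when there is none. *)
Definition fmax (R : realType) (d n j : nat) : nat :=
  let counts := [set num_faces P j | P in @cs_polytope R d n] in
  xget 0%N [set m | counts m /\ ubound counts m].

(* Main.v *)
(* Upper bound. Let V be the vertex set and, for a vertex u, put P_u = (u + P) / 2, a
   homothet of P inside P. If [u, v] is an edge, its midpoint lies on a proper face, so the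
   homothets P_u and P_(-v) have disjoint interiors. At most 2 ^ d homothets of ratio 1/2
   can have pairwise disjoint interiors inside P, so Turan's theorem bounds the number of
   such pairs (u, -v). Instead of volumes, the packing bound iterates the homothets k times
   and counts the centers in a grid of mesh 2 ^- k.

   Lower bound. For d = 2k, put n / (2k) points in each of 2k clusters +-e_i on the image of
   z |-> (z, z ^ 3). All the pairs are edges, except those in antipodal clusters. In the plane
   of two coordinates i, j the points of clusters i, j lie on the unit circle, where linear
   functionals in (z, z ^ 3) are the odd trigonometric polynomials of degree at most 3; for a,
   b on this circle, with h = 1 + a.b > 1/2, the cubic 3 h ^ 2 u - u ^ 3 in u = z.(a + b) is
   maximal exactly at a and b. *)
Require Import Defs.
From mathcomp Require Import zify ring lra.

Local Open Scope ring_scope.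

(** * Turan's theorem and two counting lemmas *)

(** Induction on the clique bound. Take [v] of maximal degree and [N] its neighbourhood: cliques in
    [N] extend by [v], so the induction hypothesis bounds the pairs inside [N], and every other
    adjacent pair has an end outside [N], of degree at most [#|N|]. The sum counts ordered pairs. *)
Lemma turan (T : finType) (e : rel T) (r : nat) (S : {set T}) :
  symmetric e -> irreflexive e ->
  (forall K : {set T}, K \subset S -> {in K &, forall x y, x != y -> e x y} ->
    (#|K| <= r)%N) ->
  (r * \sum_(x in S) #|[set y in S | e x y]| <= r.-1 * #|S| ^ 2)%N.
Proof.
move=> e_sym e_irr; elim: r S => [|r IHr] S cliqueS; first by rewrite mul0n.
have [->|[v0 Sv0]] := set_0Vmem S; first by rewrite big_set0 muln0.
pose deg x := #|[set y in S | e x y]|.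
case: (@arg_maxnP T v0 (fun x => x \in S) deg Sv0) => v Sv deg_max.
set N := [set y in S | e v y].
have NS : N \subset S by apply/fintype.subsetP => y; rewrite inE => /andP[].
have cliqueN (K : {set T}) : K \subset N ->
    {in K &, forall x y, x != y -> e x y} -> (#|K| <= r)%N.
  move=> KN cK.
  have vK : v \notin K.
    by apply/negP => /(fintype.subsetP KN); rewrite inE e_irr andbF.
  have := cliqueS (v |: K); rewrite cardsU1 vK add1n ltnS; apply.
    by rewrite finset.subUset finset.sub1set Sv (fintype.subset_trans KN NS).
  move=> x y /setU1P[->|Kx] /setU1P[->|Ky]; rewrite ?eqxx //.
  - by move: (fintype.subsetP KN _ Ky); rewrite inE => /andP[].
  - by move: (fintype.subsetP KN _ Kx); rewrite inE e_sym => /andP[].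
  - exact: cK.
have IH := IHr N cliqueN.
set eN := (\sum_(x in N) _)%N in IH.
have degE x : deg x = (#|[set y in N | e x y]| +
                       \sum_(y in S :\: N) (e x y : nat))%N.
  rewrite /deg -(cardsID N); congr (_ + _)%N.
    apply: eq_card => y; rewrite !inE; case: (y \in S); case: (e v y); rewrite ?andbF ?andbT //.
  rewrite -sum1_card big_mkcond [RHS]big_mkcond; apply: eq_bigr => y _.
  by rewrite !inE; case: (y \in S); case: (e v y); case: (e x y).
have E1 : (\sum_(x in S) deg x <= eN + 2 * ((#|S| - #|N|) * #|N|))%N.
  rewrite (big_setID N) /= (finset.setIidPr NS).
  have -> : (\sum_(x in N) deg x =
      eN + \sum_(y in S :\: N) \sum_(x in N) (e x y : nat))%N.
    by rewrite exchange_big -big_split; apply: eq_bigr => x _; rewrite degE.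
  rewrite -addnA leq_add2l mul2n -addnn.
  have cSN : (\sum_(y in S :\: N) #|N| = (#|S| - #|N|) * #|N|)%N.
    by rewrite sum_nat_const cardsD (finset.setIidPr NS).
  rewrite -!cSN; apply: leq_add; apply: leq_sum => y; rewrite inE => /andP[_ Sy].
    apply: leq_trans (deg_max _ Sy); rewrite /deg -sum1_card big_mkcond.
    rewrite [X in (_ <= X)%N]big_mkcond; apply: leq_sum => x _; rewrite !inE (e_sym y).
    by case: (x \in S); case: (e y x); case: (e v x).
  exact: deg_max.
have NleS : (#|N| <= #|S|)%N by exact: subset_leq_card.
rewrite -[X in (_ * X <= _)%N]/(\sum_(x in S) deg x)%N /=.
case: r IHr cliqueS cliqueN IH => [|q] _ _ cliqueN IH.
  have N0 : N = finset.set0.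
    apply/eqP; apply: contraT => /finset.set0Pn[y Ny].
    have := cliqueN [set y]; rewrite finset.sub1set Ny cards1; apply => //.
    by move=> a b /set1P -> /set1P ->; rewrite eqxx.
  by move: E1; rewrite /eN N0 big_set0 cards0 !muln0 leqn0 => /eqP ->; rewrite muln0.
rewrite -(leq_pmul2l (ltn0Sn q)).
set m := (#|S| - #|N|)%N in E1; have nE : #|S| = (m + #|N|)%N by rewrite subnK.
rewrite nE; have := nat_Cauchy (q.+1 * m) #|N|.
rewrite /= in IH; move: IH E1; set D := #|N|; set E := (\sum_(x in S) _)%N.
move: eN m D E {nE cliqueN degE NS NleS} => eN m D E IH E1 sq.
have E2 : (q.+2 * (q.+1 * E) <= q.+2 * (q * D ^ 2 + q.+1 * (2 * (m * D))))%N.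
  rewrite leq_mul2l /=; apply: leq_trans (_ : _ <= q.+1 * (eN + 2 * (m * D)))%N _.
    by rewrite leq_mul2l E1 orbT.
  by rewrite mulnDr leq_add2r.
rewrite mulnCA; apply: leq_trans E2 _.
(* The two sides differ by the square of [q.+1 * m - D], whose nonnegativity is [nat_Cauchy]. *)
rewrite -(leq_add2r (2 * (q.+1 * m * D))).
have -> : (q.+1 * (q.+1 * (m + D) ^ 2) + 2 * (q.+1 * m * D) =
   q.+2 * (q * D ^ 2 + q.+1 * (2 * (m * D))) + ((q.+1 * m) ^ 2 + D ^ 2))%N.
  by rewrite -!mulnn; lia.
by rewrite leq_add2l sq.
Qed.

(** The involution exchanges the elements ranked below their image with the complement of that
    set. *)
Lemma even_card_involution (T : finType) (f : T -> T) :
  involutive f -> (forall x, f x != x) -> ~~ odd #|T|.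
Proof.
move=> fK fN; pose A := [set x | (enum_rank x < enum_rank (f x))%N].
suff : #|~: A| = #|A| by move=> AE; rewrite -(cardsC A) AE addnn odd_double.
rewrite -(card_imset (mem A) (inv_inj fK)); apply: eq_card => x; rewrite -[in RHS](fK x).
rewrite (mem_imset _ _ (inv_inj fK)) !inE fK -leqNgt leq_eqVlt.
case: eqP => // /ord_inj /enum_rank_inj /eqP; by rewrite (negPf (fN x)).
Qed.

(** If [m] exceeded [q], the ratio [(m / q) ^ k] would be unbounded in [k]. *)
Lemma leq_expn_base (m q C : nat) :
  (forall k, (m ^ k <= C * q ^ k)%N) -> (m <= q)%N.
Proof.
move=> mq; rewrite leqNgt; apply/negP => qm.
(* Bernoulli's inequality [(1 + 1 / q) ^ k >= 1 + k / q], with denominators cleared. *)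
have bern k : (q ^ k * (q + k) <= q * q.+1 ^ k)%N.
  elim: k => [|k IHk]; first by rewrite !expn0 addn0 mul1n muln1.
  rewrite !expnS mulnCA; apply: leq_trans (leq_mul (leqnn q.+1) IHk).
  have : (q <= q * q ^ k + q)%N by rewrite leq_addl.
  nia.
case: (posnP q) => [q0|q_gt0].
  by move: (mq 1%N); rewrite expn1 q0 muln0 leqn0 => /eqP m0; move: qm; rewrite m0.
(* This [k] makes [q + k] exceed [q * C]. *)
have := bern (q * C).+1; set k := (q * C).+1 => bk.
have : (q ^ k * (q + k) <= q ^ k * (q * C))%N.
  apply: leq_trans bk _; rewrite [X in (_ <= X)%N]mulnCA leq_mul2l; apply/orP; right.
  by rewrite [X in (_ <= X)%N]mulnC (leq_trans _ (mq k)) // leq_exp2r.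
by rewrite leq_pmul2l ?expn_gt0 ?q_gt0 // /k; lia.
Qed.

Local Open Scope classical_set_scope.
Local Open Scope ring_scope.

(** * Linear functionals, convex sets and faces of a hull *)

(** The functional that [face] writes out as a sum; the two forms are convertible. *)
Definition dot (R : realType) (d : nat) (c x : 'rV[R]_d) : R :=
  \sum_i c ord0 i * x ord0 i.

Lemma dotDr (R : realType) (d : nat) (c x y : 'rV[R]_d) : dot c (x + y) = dot c x + dot c y.
Proof. by rewrite -big_split; apply: eq_bigr => i _; rewrite mxE mulrDr. Qed.

Lemma dotZr (R : realType) (d : nat) (a : R) (c x : 'rV[R]_d) : dot c (a *: x) = a * dot c x.
Proof. by rewrite mulr_sumr; apply: eq_bigr => i _; rewrite mxE mulrCA. Qed.

Lemma dotC (R : realType) (d : nat) (c x : 'rV[R]_d) : dot c x = dot x c.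
Proof. by apply: eq_bigr => i _; rewrite mulrC. Qed.

Lemma dotDl (R : realType) (d : nat) (c b x : 'rV[R]_d) : dot (c + b) x = dot c x + dot b x.
Proof. by rewrite dotC dotDr !(dotC x). Qed.

Lemma dotZl (R : realType) (d : nat) (a : R) (c x : 'rV[R]_d) : dot (a *: c) x = a * dot c x.
Proof. by rewrite dotC dotZr dotC. Qed.

Lemma dotNr (R : realType) (d : nat) (c x : 'rV[R]_d) : dot c (- x) = - dot c x.
Proof. by rewrite -scaleN1r dotZr mulN1r. Qed.

Lemma dotNl (R : realType) (d : nat) (c x : 'rV[R]_d) : dot (- c) x = - dot c x.
Proof. by rewrite dotC dotNr dotC. Qed.

Lemma dot0l (R : realType) (d : nat) (x : 'rV[R]_d) : dot 0 x = 0.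
Proof. by rewrite -(scale0r 0) dotZl mul0r. Qed.

Lemma dot0r (R : realType) (d : nat) (c : 'rV[R]_d) : dot c 0 = 0.
Proof. by rewrite dotC dot0l. Qed.

Lemma dot_gt0 (R : realType) (d : nat) (x : 'rV[R]_d) : x != 0 -> 0 < dot x x.
Proof.
move=> x0; rewrite lt_def; apply/andP; split; last first.
  by apply: sumr_ge0 => i _; rewrite -expr2 sqr_ge0.
apply: contra x0; rewrite psumr_eq0 => [|i _]; last by rewrite -expr2 sqr_ge0.
move/allP => h; apply/eqP/rowP => i; rewrite mxE.
by move: (h i (mem_index_enum i)) => /=; rewrite mulf_eq0 orbb => /eqP; rewrite (ord1 ord0).
Qed.

(** Replaces the weights in the library's interval type by real numbers; the endpoints impose no
    condition. *)
Lemma convex_setE (R : realType) (d : nat) (P : set 'rV[R]_d) :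
  @convex_set R 'rV[R]_d P <->
  forall (x y : 'rV[R]_d) (t : R), 0 < t -> t < 1 -> P x -> P y ->
    P (t *: x + (1 - t) *: y).
Proof.
split=> [cP x y t t0 t1 Px Py|cP].
  have t01 : Itv.spec (@Itv.num_sem R) (Itv.Real `[0%Z, 1%Z]) t.
    by rewrite /= /Itv.num_sem /= in_itv /= num_real !ltW.
  have := cP x y (Itv.mk t01); rewrite !inE; exact.
apply/convex_setW => x y; rewrite !inE => Px Py k k0 k1.
by rewrite inE; exact: (cP _ _ _ k0 k1 Px Py).
Qed.

Lemma convex_set_halfspace (R : realType) (d : nat) (c : 'rV[R]_d) (m : R) :
  @convex_set R 'rV[R]_d [set x | dot c x <= m].
Proof. by apply/convex_setE => x y t t0 t1 /= xm ym; rewrite dotDr !dotZr; nra. Qed.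

Lemma sub_convex_hull (R : realType) (d : nat) (A : set 'rV[R]_d) : A `<=` convex_hull A.
Proof. exact: sub_gen_smallest. Qed.

Lemma convex_hull_min (R : realType) (d : nat) (A P : set 'rV[R]_d) :
  @convex_set R 'rV[R]_d P -> A `<=` P -> convex_hull A `<=` P.
Proof. exact: smallest_sub. Qed.

Lemma convex_set_hull (R : realType) (d : nat) (A : set 'rV[R]_d) :
  @convex_set R 'rV[R]_d (convex_hull A).
Proof.
apply/convex_setE => x y t t0 t1 hx hy Q /= [cQ AQ].
by have /convex_setE := cQ; apply => //; [exact: hx | exact: hy].
Qed.

(** A convex combination reaches the maximum of a functional only through points that reach it. *)
Lemma convex_hull_face (R : realType) (d : nat) (A : set 'rV[R]_d) (c : 'rV[R]_d) (m : R) :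
  (forall x, A x -> dot c x <= m) ->
  [set x | convex_hull A x /\ dot c x = m] = convex_hull (A `&` [set x | dot c x = m]).
Proof.
move=> Am; apply/seteqP; split=> x.
  case=> hx cx.
  (* Points strictly below the hyperplane, together with the hull of the generators on it, form a
     convex set containing [A]. *)
  pose Q := [set x | dot c x < m \/
    dot c x = m /\ convex_hull (A `&` [set x | dot c x = m]) x].
  have cQ : @convex_set R 'rV[R]_d Q.
    apply/convex_setE => y z t t0 t1; rewrite /Q /= dotDr !dotZr => -[ym|[ym hy]] [zm|[zm hz]].
    - by left; nra.
    - by left; nra.
    - by left; nra.
    - right; split; first by nra.
      by have /convex_setE := @convex_set_hull R d (A `&` [set x | dot c x = m]); apply.
  have AQ : A `<=` Q.
    move=> y Ay; rewrite /Q /=; have := Am y Ay; rewrite le_eqVlt => /predU1P[ym|]; last by left.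
    by right; split => //; apply: sub_convex_hull.
  by have [|[]//] := convex_hull_min cQ AQ hx; rewrite cx ltxx.
move=> hx; split.
  by move: x hx; apply: convex_hull_min; [exact: convex_set_hull | move=> y [/sub_convex_hull]].
move: x hx; apply: convex_hull_min; last by move=> y [].
by apply/convex_setE => x y t t0 t1 /= xm ym; rewrite dotDr !dotZr xm ym; ring.
Qed.

(** * Dilations of a convex body and packing by half-size copies *)

(** [dil P t x] stands for the gauge of [P] at [x] being at most [t]; the lemmas below are the rules
    of a gauge. *)
Definition dil (R : realType) (d : nat) (P : set 'rV[R]_d) (t : R) : set 'rV[R]_d :=
  [set t *: x | x in P].

Section dilations.
Variables (R : realType) (d : nat) (P : set 'rV[R]_d).
Hypotheses (convP : @convex_set R 'rV[R]_d P) (P0 : P 0).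

(** Triangle inequality: [s a + t b] is [s + t] times a convex combination of [a] and [b]. Zero
    ratios are split off to avoid dividing by 0. *)
Lemma dilD (s t : R) (x y : 'rV[R]_d) : 0 <= s -> 0 <= t ->
  dil P s x -> dil P t y -> dil P (s + t) (x + y).
Proof.
move=> s0 t0 [a Pa <-] [b Pb <-].
case: (ltgtP s 0) s0 => // [s0 _|-> _]; last first.
  by exists b => //; rewrite scale0r !add0r.
case: (ltgtP t 0) t0 => // [t0 _|-> _]; last first.
  by exists a => //; rewrite scale0r !addr0.
have st : 0 < s + t by lra.
exists (s / (s + t) *: a + (1 - s / (s + t)) *: b).
  apply: (convex_setE P).1 => //; first exact: divr_gt0.
  by rewrite ltr_pdivrMr // mul1r; lra.
rewrite scalerDr !scalerA; congr (_ *: _ + _ *: _); field; lra.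
Qed.

Lemma dil0 (t : R) : dil P t 0.
Proof. by exists 0 => //; rewrite scaler0. Qed.

Lemma dil1 (x : 'rV[R]_d) : dil P 1 x <-> P x.
Proof. by split=> [[y Py <-]|Px]; [rewrite scale1r | exists x; rewrite ?scale1r]. Qed.

Lemma dilZ (a t : R) (x : 'rV[R]_d) : dil P t x -> dil P (a * t) (a *: x).
Proof. by move=> [y Py <-]; exists y => //; rewrite scalerA. Qed.

Lemma dil_le (s t : R) (x : 'rV[R]_d) : 0 <= s -> s <= t -> dil P s x -> dil P t x.
Proof.
move=> s0 st xs; rewrite -(subrKC s t) -[x]addr0.
by apply: dilD => //; [lra | exact: dil0].
Qed.

Lemma dil_sum (I : Type) (r : seq I) (w : I -> R) (x : I -> 'rV[R]_d) :
  (forall i, 0 <= w i) -> (forall i, dil P (w i) (x i)) ->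
  dil P (\sum_(i <- r) w i) (\sum_(i <- r) x i).
Proof.
move=> w0 xw; elim: r => [|i r IHr]; first by rewrite !big_nil; exact: dil0.
by rewrite !big_cons; apply: dilD => //; apply: sumr_ge0.
Qed.

End dilations.

Section packing.
Variables (R : realType) (d : nat) (P : set 'rV[R]_d) (M rho : R).
Hypotheses (convP : @convex_set R 'rV[R]_d P) (P0 : P 0).
Hypotheses (symP : forall x, P x -> P (- x)).
Hypotheses (boundP : forall x i, P x -> `|x ord0 i| <= M).
Hypotheses (rho_gt0 : 0 < rho) (ballP : forall i, P (rho *: delta_mx ord0 i)).

Lemma dilN (t : R) (x : 'rV[R]_d) : dil P t x -> dil P t (- x).
Proof. by move=> [y Py <-]; exists (- y); [exact: symP | rewrite scalerN]. Qed.

(** [P] contains the cross-polytope with vertices [+- rho e_i], so membership in a dilate follows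
    from an l1 estimate. *)
Lemma dil_cross_polytope (t : R) (y : 'rV[R]_d) :
  \sum_i `|y ord0 i| <= t * rho -> dil P t y.
Proof.
move=> yt; apply: (@dil_le _ _ _ convP P0 (\sum_i `|y ord0 i| / rho)).
- by apply: sumr_ge0 => i _; rewrite divr_ge0 // ltW.
- by rewrite -mulr_suml ler_pdivrMr.
rewrite [y in dil _ _ y]row_sum_delta; apply: dil_sum => // i.
  by rewrite divr_ge0 // ltW.
have rho0 : rho != 0 by rewrite gt_eqF.
case: (lerP 0 (y ord0 i)) => yi.
  by exists (rho *: delta_mx ord0 i) => //; rewrite scalerA mulfVK // ger0_norm.
exists (- (rho *: delta_mx ord0 i)); first exact: symP.
by rewrite scalerN scalerA mulfVK // ltr0_norm // scaleNr opprK.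
Qed.

Variables (K : finType) (u : K -> 'rV[R]_d).
Hypotheses (Pu : forall i, P (u i)).
Hypotheses (sep : forall i j t, i != j -> 0 <= t -> t < 1 ->
  ~ dil P t (2^-1 *: (u i - u j))).

(* The homothets (u i + P) / 2 have disjoint interiors inside P; iterating,
   P contains #|K| ^ k interior-disjoint homothets of ratio 2 ^- k, centered at
   the points [center w]. *)
Definition center (w : seq K) : 'rV[R]_d :=
  foldr (fun i x => 2^-1 *: (u i + x)) 0 w.

(** Each halving step turns a gauge bound [g] into [(1 + g) / 2]. Hence the copy of ratio
    [2 ^- size w] around [center w] stays inside [P]. *)
Lemma center_dil (w : seq K) : dil P (1 - 2 ^- size w) (center w).
Proof.
elim: w => [|i w IHw] /=; first exact: dil0.
have p1 : 2 ^- size w <= 1 :> R by rewrite invf_le1 ?exprn_ege1 ?exprn_gt0 // ler1n.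
have -> : 1 - 2 ^- (size w).+1 = 2^-1 * (1 + (1 - 2 ^- size w)) :> R.
  by rewrite exprS invfM; set a := (2 ^- _ : R); lra.
by apply: dilZ; apply: dilD => //; [lra | exact/dil1].
Qed.

(** For symmetric convex [P], two copies of ratio [r] have disjoint interiors when their centers
    differ by a vector of gauge at least [2 r]; [sep] and the conclusion both express disjointness
    this way. Words with equal heads reduce to their tails; otherwise [(u i - u j) / 2] is the
    difference of the centers plus a correction of gauge at most [1 - a]. *)
Lemma center_sep (v w : seq K) (t : R) : size v = size w -> v != w -> 0 <= t -> t < 1 ->
  ~ dil P (t * (2 * 2 ^- size v)) (center v - center w).
Proof.
elim: v w => [|i v IHv] [|j w] //= [vw] ne t0 t1.
set a := (2 ^- size v : R) in IHv.
have a0 : 0 < a by rewrite invr_gt0 exprn_gt0.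
have a1 : a <= 1 by rewrite invf_le1 ?exprn_ege1 ?exprn_gt0 // ler1n.
have -> : t * (2 * 2 ^- (size v).+1) = t * a by rewrite exprS invfM /a; field; rewrite expf_neq0.
move=> D; case: (eqVneq i j) => [ij|ij].
  have {}ne : v != w by apply: contra ne => /eqP ->; rewrite ij.
  apply: (IHv w vw ne t0 t1).
  have := dilZ 2 D; rewrite -scalerBr ij opprD addrACA subrr add0r scalerA divff ?pnatr_eq0 //.
  by rewrite scale1r mulrCA.
(* The total gauge [t a + (1 - a)] is below 1, which [sep] forbids. *)
apply: (@sep i j (1 - (1 - t) * a)) => //; [nra | nra |].
have Dc : dil P (1 - a) (2^-1 *: (center w - center v)).
  have -> : 1 - a = 2^-1 * ((1 - a) + (1 - a)) by lra.
  apply: dilZ; apply: dilD => //; [lra | lra | rewrite /a vw; exact: center_dil |].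
  by apply: dilN; exact: center_dil.
have -> : 1 - (1 - t) * a = t * a + (1 - a) by ring.
have -> : 2^-1 *: (u i - u j) =
    2^-1 *: (u i + center v) - 2^-1 *: (u j + center w) + 2^-1 *: (center w - center v).
  by rewrite -scalerBr -scalerDr; congr (_ *: _); apply/rowP => l; rewrite !mxE; ring.
by apply: dilD => //; [nra | lra].
Qed.

(** The [#|K| ^ k] centers lie in distinct cells of a grid with [(L * 2 ^ k) ^ d] cells; comparing
    growth in [k] leaves [2 ^ d]. *)
Lemma card_packing : (0 < d)%N -> (#|K| <= 2 ^ d)%N.
Proof.
(* With this [L], the interval [[- M, M]] is covered by [L * 2 ^ k] cells of the side [h] chosen
   below. *)
move=> d_gt0; pose L := (Num.truncn (2 * M * d%:R / rho)).+1.
have d0 : 0 < d%:R :> R by rewrite ltr0n.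
apply: (@leq_expn_base _ _ (L ^ d)) => k.
pose h : R := rho * 2 ^- k / d%:R.
have k0 : 0 < 2 ^- k :> R by rewrite invr_gt0 exprn_gt0.
have h0 : 0 < h by rewrite !mulr_gt0 // invr_gt0.
have [n nE] : {n | (L * 2 ^ k)%N = n.+1}.
  by exists (L * 2 ^ k).-1; rewrite prednK // muln_gt0 /L expn_gt0.
pose coord (x : 'rV[R]_d) (i : 'I_d) := (x ord0 i + M) / h.
have coord_ge0 x i : P x -> 0 <= coord x i.
  by move=> /(boundP i); rewrite ler_norml => /andP[xM _]; apply: divr_ge0; [lra | exact: ltW].
have coord_lt x i : P x -> (Num.truncn (coord x i) < n.+1)%N.
  move=> Px; rewrite -nE truncn_lt_nat ?coord_ge0 //.
  have : 2 * M * d%:R / rho < L%:R by exact: truncnS_gt.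
  rewrite natrM natrX /coord => HL.
  rewrite ltr_pdivrMr //.
  have -> : L%:R * 2 ^+ k * h = L%:R * rho / d%:R :> R.
    by rewrite /h; field; rewrite ?expf_neq0 //; lra.
  rewrite ltr_pdivlMr //; move: HL; rewrite ltr_pdivrMr // => HL.
  have := boundP i Px; rewrite ler_norml => /andP[_ xM]; nra.
pose cell (w : k.-tuple K) : {ffun 'I_d -> 'I_n.+1} :=
  [ffun i => inord (Num.truncn (coord (center w) i))].
have Pc (w : k.-tuple K) : P (center w).
  apply/dil1; apply: dil_le (center_dil w) => //.
    by rewrite size_tuple subr_ge0 invf_le1 ?exprn_ege1 ?exprn_gt0 // ler1n.
have cell_inj : injective cell.
  move=> v w /ffunP vw; apply/eqP; apply: contraT => ne; exfalso.
  have sv := size_tuple v.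
  (* Two points of one cell are within l1 distance [d * h = rho * 2 ^- k], so their difference has
     gauge at most [2 ^- k], half of the separation. *)
  apply: (@center_sep v w 2^-1) => //; rewrite ?size_tuple //; first lra.
  have -> : 2^-1 * (2 * 2 ^- k) = 2 ^- k :> R by lra.
  apply: dil_cross_polytope.
  have -> : 2 ^- k * rho = \sum_(i < d) h.
    by rewrite sumr_const card_ord -[RHS]mulr_natr /h mulfVK ?gt_eqF // mulrC.
  apply: ler_sum => i _; rewrite !mxE.
  have := vw i; rewrite !ffunE => /(congr1 (@nat_of_ord n.+1)); rewrite !inordK ?coord_lt // => tE.
  have /truncn_itv /andP[vl vu] := coord_ge0 _ i (Pc v).
  have /truncn_itv /andP[wl wu] := coord_ge0 _ i (Pc w).
  rewrite tE -natr1 in vl vu; rewrite -natr1 in wu.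
  rewrite ler_pdivlMr // in vl; rewrite ler_pdivlMr // in wl.
  rewrite ltr_pdivrMr // in vu; rewrite ltr_pdivrMr // in wu.
  rewrite ler_norml; apply/andP; split; lra.
have := leq_card cell cell_inj.
by rewrite card_tuple card_ffun !card_ord -nE expnMn -!expnM (mulnC k).
Qed.

End packing.

(** * Dimension, vertices and edges of polytopes *)

Lemma convex_set1 (R : realType) (d : nat) (v : 'rV[R]_d) : @convex_set R 'rV[R]_d [set v].
Proof.
apply/convex_setE => x y t t0 t1 -> ->.
by rewrite -scalerDl addrC subrK scale1r.
Qed.

Lemma convex_hull1 (R : realType) (d : nat) (v : 'rV[R]_d) : convex_hull [set v] = [set v].
Proof.
apply/seteqP; split; last exact: sub_convex_hull.
by apply: convex_hull_min => //; exact: convex_set1.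
Qed.

Lemma convex_hull0 (R : realType) (d : nat) : convex_hull set0 = set0 :> set 'rV[R]_d.
Proof.
apply/seteqP; split => //; apply: convex_hull_min => //.
Qed.

Lemma convex_hullS (R : realType) (d : nat) (A B : set 'rV[R]_d) :
  A `<=` B -> convex_hull A `<=` convex_hull B.
Proof.
move=> AB; apply: convex_hull_min; first exact: convex_set_hull.
by apply: subset_trans AB _; exact: sub_convex_hull.
Qed.

Lemma convex_hull_sym (R : realType) (d : nat) (A : set 'rV[R]_d) :
  (forall x, A x -> A (- x)) -> forall x, convex_hull A x -> convex_hull A (- x).
Proof.
move=> symA; apply: (@convex_hull_min _ _ _ [set x | convex_hull A (- x)]).
  apply/convex_setE => x y t t0 t1 /= hx hy; rewrite opprD -!scalerN.
  by have /convex_setE := @convex_set_hull R d A; apply.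
by move=> x Ax /=; apply: sub_convex_hull; exact: symA.
Qed.

Lemma convex_hull_le (R : realType) (d : nat) (A : set 'rV[R]_d) (c : 'rV[R]_d) (m : R) :
  (forall x, A x -> dot c x <= m) -> forall x, convex_hull A x -> dot c x <= m.
Proof. by move=> Am; apply: convex_hull_min; first exact: convex_set_halfspace. Qed.

Lemma affine_hull1 (R : realType) (d : nat) (v : 'rV[R]_d) : affine_hull [set v] = [set v].
Proof.
apply/seteqP; split=> [p [k [x [w [xA w1 ->]]]] /=|p ->].
  rewrite (eq_bigr (fun i => w i *: v)) => [|i _]; last by rewrite (xA i).
  by rewrite -scaler_suml w1 scale1r.
by exists 1%N, (fun=> v), (fun=> 1); split=> //; rewrite big_ord1 ?scale1r.
Qed.

Lemma sub_affine_hull (R : realType) (d : nat) (A : set 'rV[R]_d) : A `<=` affine_hull A.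
Proof.
move=> p Ap.
by exists 1%N, (fun=> p), (fun=> 1); split=> //; rewrite big_ord1 ?scale1r.
Qed.

Lemma affine_hull_neq0 (R : realType) (d : nat) (A : set 'rV[R]_d) (p : 'rV[R]_d) :
  affine_hull A p -> A !=set0.
Proof.
move=> [[|k] [x [w [xA w1 _]]]]; last by exists (x ord0).
by move: w1; rewrite big_ord0 => /eqP; rewrite eq_sym oner_eq0.
Qed.

Lemma has_dim0 (R : realType) (d : nat) (A : set 'rV[R]_d) :
  has_dim A 0 <-> exists v, A = [set v].
Proof.
split=> [[x0 [U [AU /eqP]]]|[v ->]]; last first.
  exists v, 0%VS; rewrite dimv0 affine_hull1; split => //.
  apply/seteqP; split=> [p ->|p [u /=]]; first by exists 0; rewrite ?addr0 //= mem0v.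
  by rewrite memv0 => /eqP -> <-; rewrite addr0.
rewrite dimv_eq0 => /eqP U0.
have sub p : affine_hull A p -> p = x0.
  by rewrite AU => -[u /=]; rewrite U0 memv0 => /eqP -> <-; rewrite addr0.
have [|p Ap] := @affine_hull_neq0 R d A x0.
  by rewrite AU; exists 0; rewrite ?addr0 //= mem0v.
exists x0; apply/seteqP; split=> q; first by move=> /sub_affine_hull/sub.
by move=> ->; rewrite -(sub p) //; exact: sub_affine_hull.
Qed.

Lemma has_dim1_line (R : realType) (d : nat) (A : set 'rV[R]_d) : has_dim A 1 ->
  exists x0 u : 'rV[R]_d, [/\ u != 0, forall x, A x -> exists t, x = x0 + t *: u &
    forall v, ~ A `<=` [set v]].
Proof.
move=> [x0 [U [AU dU]]]; have U0 : U != 0%VS by rewrite -dimv_eq0 dU.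
pose u := vpick U; have u0 : u != 0 by rewrite vpick0.
have UE : U = <[u]>%VS.
  apply/esym/eqP; rewrite eqEdim dU dim_vline u0 andbT.
  by rewrite -memvE memv_pick.
exists x0, u; split => // [x /sub_affine_hull|v Av].
  by rewrite AU => -[y /=]; rewrite UE => /vlineP[t ->] <-; exists t.
have sub p : affine_hull A p -> p = v.
  move=> hp; have : affine_hull [set v] p; last by rewrite affine_hull1.
  by move: hp => [k [x [w [xA w1 ->]]]]; exists k, x, w; split => // i; exact: Av.
have h0 : affine_hull A x0 by rewrite AU; exists 0; rewrite ?addr0 //= mem0v.
have hu : affine_hull A (x0 + u) by rewrite AU; exists u => //=; exact: memv_pick.
have := sub _ hu; rewrite -(sub _ h0) => /eqP.
by rewrite -subr_eq0 addrAC subrr add0r (negPf u0).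
Qed.

Lemma has_dim_segment (R : realType) (d : nat) (u v : 'rV[R]_d) : u != v ->
  has_dim (convex_hull [set u; v]) 1.
Proof.
move=> uv; exists u, <[v - u]>%VS; split; last first.
  by rewrite dim_vline subr_eq0 eq_sym uv.
apply/seteqP; split=> [p [k [x [w [xA w1 ->]]]]|p [y /= /vlineP[t ->] <-]].
  have sub : convex_hull [set u; v] `<=` [set u + t *: (v - u) | t in setT].
    apply: convex_hull_min => [|z [->|->]].
    - apply/convex_setE => y z t t0 t1 [a _ <-] [b _ <-].
      exists (t * a + (1 - t) * b) => //.
      by apply/rowP => l; rewrite !mxE; ring.
    - by exists 0; rewrite // scale0r addr0.
    - by exists 1; rewrite // scale1r addrC subrK.
  have /choice[s sE] i : exists s, u + s *: (v - u) = x i.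
    by have [s _ <-] := sub _ (xA i); exists s.
  exists ((\sum_i w i * s i) *: (v - u)) => /=; first by apply/vlineP; eexists.
  rewrite -{1}[u]scale1r -w1 !scaler_suml -big_split; apply: eq_bigr => i _ /=.
  by rewrite -sE [RHS]scalerDr scalerA.
exists 2%N, (fun i => if i == ord0 then u else v), (fun i => if i == ord0 then 1 - t else t).
split.
- by move=> i; apply: sub_convex_hull; case: ifP => _; [left | right].
- by rewrite big_ord_recl big_ord1 /= subrK.
- by rewrite big_ord_recl big_ord1 /=; apply/rowP => l; rewrite !mxE; ring.
Qed.

Lemma faceE (R : realType) (d : nat) (A F : set 'rV[R]_d) : face (convex_hull A) F ->
  exists (c : 'rV[R]_d) (m : R), [/\ forall x, A x -> dot c x <= m,
    F = [set x | convex_hull A x /\ dot c x = m] &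
    F = convex_hull (A `&` [set x | dot c x = m])].
Proof.
move=> [c [m [Pm ->]]]; exists c, m.
have Am x : A x -> dot c x <= m by move=> Ax; apply: Pm; exact: sub_convex_hull.
by split => //; rewrite -convex_hull_face.
Qed.

Lemma face_convex_hull (R : realType) (d : nat) (A : set 'rV[R]_d) (c : 'rV[R]_d) (m : R) :
  (forall x, A x -> dot c x <= m) ->
  face (convex_hull A) (convex_hull (A `&` [set x | dot c x = m])).
Proof.
move=> Am; exists c, m; split; last by rewrite -convex_hull_face.
exact: convex_hull_le.
Qed.

(** A face is the hull of the generators on its hyperplane, so faces are no more numerous than sets
    of generators. This makes the [fset_set] in [num_faces] the true set of faces. *)
Lemma finite_faces (R : realType) (d : nat) (P : set 'rV[R]_d) (D : set (set 'rV[R]_d)) :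
  polytope P -> finite_set [set F | face P F /\ D F].
Proof.
move=> [A /finite_fsetP[B ->] ->].
apply: (@sub_finite_set _ _ [set convex_hull [set` C] | C in [set` fpowerset B]]); last first.
  by apply: finite_image; exact: finite_fset.
move=> F [/faceE[c [m [_ _ ->]]] _].
exists [fset x in B | `[< dot c x = m >]]%fset.
  by rewrite /= fpowersetE; apply/fsubsetP => x; rewrite !inE => /andP[].
congr convex_hull; apply/seteqP; split=> x /=; rewrite !inE /=.
  by move=> /andP[-> /asboolP].
by move=> [-> xm]; apply/asboolP.
Qed.

Lemma set1_inj (T : Type) : injective (fun v : T => [set v]).
Proof. by move=> u v /seteqP[+ _] => /(_ u erefl). Qed.

Lemma finite_vertices (R : realType) (d : nat) (P : set 'rV[R]_d) :
  polytope P -> finite_set [set v | face P [set v]].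
Proof.
move=> polP; have fin := @finite_faces R d P setT polP.
have -> : [set v | face P [set v]] =
    (fun v => [set v]) @^-1` [set F | face P F /\ setT F].
  by apply/seteqP; split=> v /= => [? | -[? _]].
by apply: finite_preimage => // u v _ _; exact: set1_inj.
Qed.

Lemma num_faces0 (R : realType) (d : nat) (P : set 'rV[R]_d) : polytope P ->
  num_faces P 0 = #|` fset_set [set v | face P [set v]] |.
Proof.
move=> polP; rewrite /num_faces.
have -> : [set F | face P F /\ has_dim F 0] = [set [set v] | v in [set v | face P [set v]]].
  apply/seteqP; split=> [F [PF /has_dim0[v Fv]]|F [v Pv <-]].
    by exists v => //=; rewrite -Fv.
  by split => //; apply/has_dim0; exists v.
rewrite fset_set_image; last exact: finite_vertices.
by rewrite card_imfset //; exact: set1_inj.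
Qed.

Lemma seq_argmin (R : realType) (T : eqType) (f : T -> R) (s : seq T) :
  s != [::] -> exists2 a, a \in s & forall x, x \in s -> f a <= f x.
Proof.
elim: s => // x s IHs _; have [->|/IHs[a sa amin]] := eqVneq s [::].
  by exists x; rewrite ?mem_head // => y; rewrite inE => /eqP ->.
have [xa|ax] := leP (f x) (f a).
  exists x; rewrite ?mem_head // => y; rewrite inE => /predU1P[->//|/amin].
  exact: le_trans.
exists a; rewrite ?inE ?sa ?orbT // => y /predU1P[->|/amin//]; exact: ltW.
Qed.

(** Gives the size of a perturbation that preserves finitely many strict inequalities. *)
Lemma seq_small_scale (R : realType) (T : eqType) (g h : T -> R) (s : seq T) :
  (forall x, x \in s -> 0 < g x) ->
  exists2 e : R, 0 < e & forall x, x \in s -> e * h x < g x.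
Proof.
elim: s => [_|x s IHs gs]; first by exists 1.
have [y ys|e e0 es] := IHs; first by apply: gs; rewrite inE ys orbT.
have gx : 0 < g x by apply: gs; rewrite mem_head.
have k0 : 0 < `|h x| + 1 by rewrite ltr_wpDl.
(* The added 1 keeps the denominator positive when [h x] vanishes. *)
exists (Num.min e (g x / (`|h x| + 1))); first by rewrite lt_min e0 divr_gt0.
move=> y; rewrite inE; set q := Num.min _ _.
have q0 : 0 < q by rewrite lt_min e0 divr_gt0.
have qe : q <= e by rewrite ge_min lexx.
have qg : q * (`|h x| + 1) <= g x by rewrite -ler_pdivlMr // ge_min lexx orbT.
case/predU1P => [->|ys].
  have := ler_norm (h x); nra.
case: (ltP 0 (h y)) => hy.
  by apply: le_lt_trans (es y ys); rewrite ler_wpM2r // ltW.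
have gy : 0 < g y by apply: gs; rewrite inE ys orbT.
by apply: le_lt_trans gy; nra.
Qed.

(* The functional [c - e w] exposes [a] for small [e]. *)
Lemma face_vertex (R : realType) (d : nat) (B : {fset 'rV[R]_d}) (c w a : 'rV[R]_d) (m : R) :
  (forall x, x \in B -> dot c x <= m) -> a \in B -> dot c a = m ->
  (forall x, x \in B -> dot c x = m -> x != a -> dot w a < dot w x) ->
  face (convex_hull [set` B]) [set a].
Proof.
move=> Bm Ba am amin.
have [|e e0 es] := @seq_small_scale R _ (fun x => m - dot c x)
    (fun x => dot w a - dot w x) [seq x <- B | dot c x < m].
  by move=> x; rewrite mem_filter subr_gt0 => /andP[].
have lt x : x \in B -> x != a -> dot (c - e *: w) x < m - e * dot w a.
  move=> Bx xa; rewrite -scaleNr dotDl dotZl mulNr.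
  have := Bm x Bx; rewrite le_eqVlt => /predU1P[xm|xm].
    have := amin x Bx xm xa; nra.
  have := es x; rewrite mem_filter xm Bx => /(_ isT); nra.
have ea : dot (c - e *: w) a = m - e * dot w a.
  by rewrite -scaleNr dotDl dotZl mulNr am.
have -> : [set a] = convex_hull ([set` B] `&` [set x | dot (c - e *: w) x = m - e * dot w a]).
  rewrite -convex_hull1; congr convex_hull; apply/seteqP; split=> [x ->|x [/= Bx xm]] //.
  by apply/eqP; apply: contraT => /(lt x Bx); rewrite xm ltxx.
apply: face_convex_hull => x Bx; have [->|/(lt x Bx)/ltW//] := eqVneq x a.
by rewrite ea.
Qed.

Lemma segment_hull (R : realType) (d : nat) (a b : 'rV[R]_d) (t : R) : 0 <= t -> t <= 1 ->
  convex_hull [set a; b] (t *: a + (1 - t) *: b).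
Proof.
rewrite le_eqVlt => /predU1P[<- _|t0].
  by rewrite scale0r add0r subr0 scale1r; apply: sub_convex_hull; right.
rewrite le_eqVlt => /predU1P[->|t1].
  by rewrite subrr scale0r addr0 scale1r; apply: sub_convex_hull; left.
have /convex_setE cH := @convex_set_hull R d [set a; b].
by apply: cH => //; apply: sub_convex_hull; [left|right].
Qed.

(** On the line carrying [F] the functional [dot u] is injective, so each of its extreme values over
    the generators on [F] is taken at one point only. Perturbing [c] by multiples of [u] exposes
    these two points as vertices. *)
Lemma edge_endpoints (R : realType) (d : nat) (P F : set 'rV[R]_d) :
  polytope P -> face P F -> has_dim F 1 ->
  exists a b, [/\ a != b, face P [set a], face P [set b] & F = convex_hull [set a; b]].
Proof.
move=> [A /finite_fsetP[B ->] ->] {P A} /faceE[c [m [Bm _ FE]]].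
move=> /has_dim1_line[x0 [u [u0 lineF F1]]].
have uu := dot_gt0 u0.
have inj x y : F x -> F y -> dot u x = dot u y -> x = y.
  move=> /lineF[s ->] /lineF[t ->]; rewrite !dotDr !dotZr => /addrI.
  by move/(mulIf (lt0r_neq0 uu)) => ->.
pose G := [seq x <- B | dot c x == m].
have GE : [set` B] `&` [set x | dot c x = m] = [set` G].
  apply/seteqP; split=> x /=; rewrite mem_filter.
    by move=> [-> ->]; rewrite eqxx.
  by move=> /andP[/eqP].
have GF x : x \in G -> F x by move=> Gx; rewrite FE GE; exact: sub_convex_hull.
have G0 : G != [::].
  apply/eqP => G0; apply: (F1 0); rewrite FE GE G0.
  have -> : [set` [::]] = set0 :> set 'rV[R]_d by apply/seteqP; split.
  by rewrite convex_hull0.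
have [a Ga amin] := seq_argmin (dot u) G0.
have [b Gb bmax] := seq_argmin (dot (- u)) G0.
have {}bmax x : x \in G -> dot u x <= dot u b.
  by move=> /bmax; rewrite !dotNl lerN2.
have mG x : (x \in G) = (dot c x == m) && (x \in B) by rewrite mem_filter.
have [/eqP ca Ba] : dot c a == m /\ a \in B by move: Ga; rewrite mG => /andP[].
have [/eqP cb Bb] : dot c b == m /\ b \in B by move: Gb; rewrite mG => /andP[].
have ab : dot u a < dot u b.
  rewrite lt_def amin // andbT; apply/eqP => ba; apply: (F1 a).
  rewrite FE GE -[X in _ `<=` X]convex_hull1; apply: convex_hullS => x /= Gx.
  apply: inj; [exact: GF | exact: GF |].
  by apply/eqP; rewrite eq_le amin // -ba bmax.
have aF := GF _ Ga; have bF := GF _ Gb.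
exists a, b; split.
- by apply: contraTneq ab => ->; rewrite ltxx.
- apply: (@face_vertex _ _ _ c u a m) => // x Bx cx xa.
  have Gx : x \in G by rewrite mG cx eqxx.
  rewrite lt_def amin // andbT; apply: contra xa => /eqP; move/inj => -> //.
  exact: GF.
- apply: (@face_vertex _ _ _ c (- u) b m) => // x Bx cx xb.
  have Gx : x \in G by rewrite mG cx eqxx.
  rewrite !dotNl ltrN2 lt_def bmax // andbT.
  by apply: contra xb => /eqP; move/inj => <- //; exact: GF.
apply/seteqP; split; last first.
  by rewrite FE GE; apply: convex_hullS => x [] ->.
rewrite FE GE; apply: convex_hull_min; first exact: convex_set_hull.
move=> x /= Gx; have xF := GF _ Gx; have la := amin _ Gx; have lb := bmax _ Gx.
(* The barycentric weight of [a], read off from [dot u]; injectivity then identifies [x]. *)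
pose t := (dot u b - dot u x) / (dot u b - dot u a).
have D0 : dot u b - dot u a != 0 by rewrite subr_eq0 gt_eqF.
have D1 : 0 < dot u b - dot u a by rewrite subr_gt0.
have t0 : 0 <= t by rewrite divr_ge0 ?subr_ge0 // ltW.
have t1 : t <= 1 by rewrite ler_pdivrMr // mul1r lerB.
have abx := @segment_hull R d a b t t0 t1.
suff -> : x = t *: a + (1 - t) *: b by [].
apply: inj => //.
  by rewrite FE GE; apply: convex_hullS abx => y [] ->.
by rewrite dotDr !dotZr /t; field.
Qed.

(** A subspace is recovered from any of its translates as the set of differences. *)
Lemma has_dim_inj (R : realType) (d : nat) (A : set 'rV[R]_d) (j k : nat) :
  has_dim A j -> has_dim A k -> j = k.
Proof.
have sub (x y : 'rV[R]_d) (U W : {vspace 'rV[R]_d}) :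
    [set x + u | u in [set` U]] = [set y + w | w in [set` W]] -> (U <= W)%VS.
  move=> UW; apply/subvP => u Uu.
  have Wx v : v \in U -> x + v - y \in W.
    move=> Uv; have [w /= Ww <-] : [set y + w | w in [set` W]] (x + v).
      by rewrite -UW; exists v.
    by rewrite addrC addKr.
  have -> : u = (x + u - y) - (x + 0 - y) by rewrite addr0 opprB addrA subrK addrAC subrr add0r.
  by apply: rpredB; apply: Wx; rewrite ?mem0v.
move=> [x [U [AU <-]]] [y [W [AW <-]]]; rewrite AU in AW.
by apply/eqP; rewrite eqn_leq !dimvS // ; [exact: sub (esym AW) | exact: sub AW].
Qed.

Lemma has_dim_full (R : realType) (d : nat) (A : set 'rV[R]_d) :
  has_dim A d <-> affine_hull A = setT.
Proof.
have dT : \dim {:'rV[R]_d} = d by rewrite dimvf /dim /= mul1n.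
split=> [[x0 [U [-> dU]]]|AT].
  have -> : U = fullv by apply/eqP; rewrite eqEdim subvf /= dT dU.
  apply/seteqP; split => // y _; exists (y - x0); rewrite /= ?memvf //.
  by rewrite addrC subrK.
exists 0, fullv; split; last by [].
by rewrite AT; apply/seteqP; split => // y _; exists y; rewrite /= ?memvf // add0r.
Qed.

(** * Centrally symmetric polytopes and the upper bound on edges *)

Section centrally_symmetric_polytope.
Variables (R : realType) (d : nat) (P : set 'rV[R]_d).
Hypotheses (polP : polytope P) (csP : centrally_symmetric P) (dimP : has_dim P d).

Lemma polytope_convex : @convex_set R 'rV[R]_d P.
Proof. by have [A _ ->] := polP; exact: convex_set_hull. Qed.

Lemma cs_opp (x : 'rV[R]_d) : P x -> P (- x).
Proof. by move=> Px; rewrite csP; exists x. Qed.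

Lemma cs_mem0 : P 0.
Proof.
have aT := (has_dim_full P).1 dimP.
have [|x Px] := @affine_hull_neq0 R d P 0; first by rewrite aT.
have := (convex_setE P).1 polytope_convex x (- x) 2^-1.
rewrite scalerN; have -> : 1 - 2^-1 = 2^-1 :> R by lra.
by rewrite subrr; apply; [lra | lra | | exact: cs_opp].
Qed.

Lemma polytope_bounded : exists M : R, forall x i, P x -> `|x ord0 i| <= M.
Proof.
have [A /finite_fsetP[B ->] ->] := polP.
exists (\sum_(x <- B) \sum_i `|x ord0 i|) => x i; move: x.
apply: (@convex_hull_min _ _ _ [set x | `|x ord0 i| <= _]).
  apply/convex_setE => x y t t0 t1 /= xm ym; rewrite !mxE.
  have t1' : 0 <= 1 - t by lra.
  apply: le_trans (ler_normD _ _) _; rewrite !normrM (ger0_norm (ltW t0)) (ger0_norm t1').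
  nra.
move=> x /= Bx; rewrite (big_rem x) //= (bigD1 i) //= -addrA ler_wpDr // addr_ge0 //.
  by apply: sumr_ge0.
by apply: sumr_ge0 => y _; apply: sumr_ge0.
Qed.

(** Each [e_i] is an affine combination of points of [P]. Symmetry absorbs the signs of the weights,
    so [e_i] lies in the dilate of [P] by the sum of their absolute values. *)
Lemma cs_ball : exists2 rho : R, 0 < rho & forall i, P (rho *: delta_mx ord0 i).
Proof.
have dl i : exists s : R, 0 <= s /\ dil P s (delta_mx ord0 i).
  have : affine_hull P (delta_mx ord0 i) by rewrite (has_dim_full P).1.
  move=> [k [x [w [xP _ ->]]]]; exists (\sum_i `|w i|); split; first exact: sumr_ge0.
  apply: dil_sum => //; [exact: polytope_convex | exact: cs_mem0 |] => j.
  case: (ger0P (w j)) => wj; first by exists (x j).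
  by exists (- x j); [exact: cs_opp | rewrite scalerN scaleNr opprK].
have /choice[s sP] := dl.
have S0 : 0 < 1 + \sum_i s i.
  by rewrite ltr_wpDr // sumr_ge0 // => i _; have [] := sP i.
exists (1 + \sum_i s i)^-1; first by rewrite invr_gt0.
move=> i; have [si0 /(dil_le polytope_convex cs_mem0)] := sP i.
move=> /(_ (1 + \sum_i s i) si0) [|y Py <-].
  rewrite (bigD1 i) //= addrCA ler_wpDr // addr_ge0 // sumr_ge0 // => j _.
  by have [] := sP j.
by rewrite scalerA mulVf ?scale1r // gt_eqF.
Qed.

(** The functional [c] equals [m] at the midpoint and is at most [t * m] on the dilate by [t], which
    is a contradiction once [m > 0]. *)
Lemma midpoint_not_interior (F : set 'rV[R]_d) (j : nat) (a b : 'rV[R]_d) (t : R) :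
  (j < d)%N -> face P F -> has_dim F j -> F a -> F b -> 0 <= t -> t < 1 ->
  ~ dil P t (2^-1 *: (a + b)).
Proof.
move=> jd [c [m [Pm FE]]] dF Fa Fb t0 t1.
have m_ge0 : 0 <= m by have := Pm _ cs_mem0; rewrite -/(dot c 0) dot0r.
have m_gt0 : 0 < m.
  (* If [m] were 0, symmetry would make [c] vanish on [P], and [F = P] would have dimension [d]. *)
  rewrite lt_def m_ge0 andbT; apply: contraTneq jd => m0.
  suff FP : F = P by rewrite (has_dim_inj dF (_ : has_dim F d)) ?ltnn // FP.
  rewrite FE; apply/seteqP; split=> [x []//|x Px]; split => //.
  apply/eqP; rewrite eq_le Pm //= m0 -oppr_le0 -[X in - X]/(dot c x) -dotNr -m0.
  by apply: Pm; exact: cs_opp.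
have [_ ca] : P a /\ dot c a = m by move: Fa; rewrite FE.
have [_ cb] : P b /\ dot c b = m by move: Fb; rewrite FE.
move=> [y Py /(congr1 (dot c))]; rewrite !dotZr dotDr ca cb.
have := Pm y Py; rewrite -/(dot c y); nra.
Qed.

Lemma cs_vertexN (v : 'rV[R]_d) : face P [set v] -> face P [set - v].
Proof.
move=> [c [m [Pm vE]]]; exists (- c), m; split.
  by move=> x Px; rewrite -/(dot (- c) x) dotNl -dotNr; apply: Pm; exact: cs_opp.
apply/seteqP; split=> x /=.
  move=> ->; have [vP' cv] : P v /\ dot c v = m by have /seteqP[/(_ _ erefl)] := vE.
  by split; [exact: cs_opp | rewrite -/(dot (- c) _) dotNl dotNr opprK].
rewrite -/(dot (- c) x) => -[Px cx].
suff : [set v] (- x) by move=> <-; rewrite opprK.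
by rewrite vE; split; [exact: cs_opp | rewrite -/(dot c (- x)) dotNr -cx dotNl].
Qed.

(** Negation is an involution of the vertices. It fixes none: the origin, as the midpoint of itself
    with itself, lies on no proper face. *)
Lemma even_vertices : (0 < d)%N -> ~~ odd (num_faces P 0).
Proof.
move=> d_gt0; rewrite num_faces0 //; set V := fset_set _.
have VE v : (v \in V) = `[< face P [set v] >].
  by rewrite in_fset_set; [rewrite /in_mem /= /in_set | exact: finite_vertices].
have oppV (v : V) : - \val v \in V.
  by rewrite VE; apply/asboolP/cs_vertexN/asboolP; rewrite -VE; exact: valP.
rewrite cardfE; apply: (@even_card_involution _ (fun v : V => [` oppV v]%fset)).
  by move=> v; apply: val_inj; rewrite /= opprK.
move=> v; apply/eqP => /(congr1 val) /= vN.
have v0 : \val v = 0.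
  have : 2 *: \val v = 0 by rewrite scaler_nat mulr2n -[X in X + _]vN addNr.
  by move=> /eqP; rewrite scaler_eq0 pnatr_eq0 /= => /eqP.
have Pv : face P [set \val v] by apply/asboolP; rewrite -VE; exact: valP.
apply: (@midpoint_not_interior [set \val v] 0 0 0 0) => //.
- by apply/has_dim0; exists (\val v).
- by rewrite addr0 scaler0; apply: dil0; exact: cs_mem0.
Qed.

(** Turan's theorem for the relation [e]: the half-size copies at [u] and [v] have disjoint
    interiors. Its cliques are packings. An edge with ends [a], [b] yields the related ordered pairs
    [(a, -b)] and [(b, -a)], and a vertex [v] yields [(v, -v)]: twice the edges plus [n] in all. *)
Lemma edges_bound (n : nat) : (1 < d)%N -> num_faces P 0 = n ->
  (2 ^ d * (2 * num_faces P 1 + n) <= (2 ^ d).-1 * n ^ 2)%N.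
Proof.
move=> d_gt1; rewrite num_faces0 //; set V := fset_set _.
rewrite /num_faces; set E := fset_set _ => nE.
have finV : finite_set [set v | face P [set v]] by exact: finite_vertices.
have VP (v : V) : face P [set \val v].
  by have := valP v; rewrite in_fset_set // inE.
have PV v : P v -> face P [set v] -> v \in V by move=> _ ?; rewrite in_fset_set // inE.
have vP (v : V) : P (\val v) by have [c [m [_ /seteqP[+ _]]]] := VP v; move=> /(_ _ erefl)[].
have oppV (v : V) : - \val v \in V.
  by apply: PV; [exact: cs_opp | exact: cs_vertexN].
pose neg (v : V) : V := [` oppV v]%fset.
have negE v : \val (neg v) = - \val v by [].
clearbody neg.
pose e : rel V := fun u v => `[< forall t : R, 0 <= t -> t < 1 ->
  ~ dil P t (2^-1 *: (\val u - \val v)) >].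
have e_irr : irreflexive e.
  move=> u; apply/asboolP => /(_ 0); apply => //.
  by rewrite subrr scaler0; apply: dil0; exact: cs_mem0.
have e_sym : symmetric e.
  suff sub u v : e u v -> e v u by move=> u v; apply/idP/idP; exact: sub.
  move=> /asboolP uv; apply/asboolP => t t0 t1 D; apply: (uv t) => //.
  by rewrite -opprB scalerN; apply: dilN => //; exact: cs_opp.
have [M bdP] := polytope_bounded.
have [rho rho0 ball] := cs_ball.
have clique (K : {set V}) : K \subset finset.setTfor V ->
    {in K &, forall x y, x != y -> e x y} -> (#|K| <= 2 ^ d)%N.
  move=> _ cK; have := @card_packing R d P M rho polytope_convex cs_mem0 cs_opp bdP rho0 ball
    {x | x \in K} (fun x => \val (\val x)).
  rewrite card_sig; apply => //; last exact: ltnW.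
  move=> i j t ij; have /asboolP := cK _ _ (valP i) (valP j) ij; exact.
have := turan e_sym e_irr clique; rewrite cardsT -cardfE -/V => T.
rewrite -nE; apply: leq_trans T; rewrite leq_mul2l; apply/orP; right.
have finE : finite_set [set F | face P F /\ has_dim F 1] by exact: finite_faces.
have ends (F : E) : exists ab : V * V, [/\ ab.1 != ab.2, e ab.1 (neg ab.2),
    e ab.2 (neg ab.1) & \val F = convex_hull [set \val ab.1; \val ab.2]].
  have := valP F; rewrite in_fset_set // inE => -[PF dF].
  have [a [b [ab Pa Pb FE]]] := edge_endpoints polP PF dF.
  have Va : a \in V by rewrite in_fset_set // inE.
  have Vb : b \in V by rewrite in_fset_set // inE.
  have Fa : \val F a by rewrite FE; apply: sub_convex_hull; left.
  have Fb : \val F b by rewrite FE; apply: sub_convex_hull; right.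
  exists ([` Va], [` Vb])%fset; split => //.
  - apply/asboolP => t t0 t1; rewrite negE opprK /=.
    exact: (midpoint_not_interior d_gt1 PF dF).
  - apply/asboolP => t t0 t1; rewrite negE opprK /=.
    exact: (midpoint_not_interior d_gt1 PF dF).
have /choice[f fP] := ends.
pose g (x : E * bool + V) : V * V := match x with
  | inl (F, true) => ((f F).1, neg (f F).2)
  | inl (F, false) => ((f F).2, neg (f F).1)
  | inr v => (v, neg v) end.
have neg_inj : injective neg.
  by move=> u v /(congr1 val); rewrite !negE => /oppr_inj /val_inj.
have fin F G : [set (f F).1; (f F).2] = [set (f G).1; (f G).2] -> F = G.
  move=> FG; apply: val_inj; have [_ _ _ ->] := fP F; have [_ _ _ ->] := fP G.
  congr convex_hull; apply/seteqP; split=> x.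
    have im u : [set (f F).1; (f F).2] u -> [set \val (f G).1; \val (f G).2] (\val u).
      by rewrite FG => -[->|->]; [left|right].
    by move=> [->|->]; apply: im; [left|right].
  have im u : [set (f G).1; (f G).2] u -> [set \val (f F).1; \val (f F).2] (\val u).
    by rewrite -FG => -[->|->]; [left|right].
  by move=> [->|->]; apply: im; [left|right].
(* An edge is determined by its ends, and as these are distinct its pairs are never of the form
   [(v, -v)]. *)
have g_inj : injective g.
  have ne F : (f F).1 != (f F).2 by have [] := fP F.
  move=> [[F []]|u] [[G []]|v] //= [].
  - by move=> E1 /neg_inj E2; rewrite (@fin F G) // E1 E2.
  - move=> E1 /neg_inj E2; have FG : F = G by apply: fin; rewrite E1 E2 setUC.
    by move: (ne G); rewrite -E1 FG eqxx.
  - by move=> E1 /neg_inj E2; move: (ne F); rewrite E1 E2 eqxx.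
  - move=> E1 /neg_inj E2; have FG : F = G by apply: fin; rewrite E1 E2 setUC.
    by move: (ne G); rewrite -E2 FG eqxx.
  - by move=> E1 /neg_inj E2; rewrite (@fin F G) // E1 E2.
  - by move=> E1 /neg_inj E2; move: (ne F); rewrite E1 E2 eqxx.
  - by move=> E1 /neg_inj E2; move: (ne G); rewrite -E1 E2 eqxx.
  - by move=> E1 /neg_inj E2; move: (ne G); rewrite -E1 E2 eqxx.
  - by move=> ->.
have -> : (2 * #|` E| + #|` V|)%N = #|{: E * bool + V}|.
  by rewrite card_sum card_prod card_bool -!cardfE mulnC.
rewrite -(card_imset _ g_inj).
have -> : (\sum_(x in finset.setTfor V) #|[set y in finset.setTfor V | e x y]%SET| =
    #|[set p : V * V | e p.1 p.2]%SET|)%N.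
  rewrite -[RHS]sum1_card (eq_bigl (fun p : V * V => true && e p.1 p.2)); last first.
    by move=> p; rewrite inE.
  rewrite -(pair_big_dep (fun=> true) e (fun _ _ => 1%N)) /=; apply: eq_big => [u|u _].
    by rewrite inE.
  by rewrite -sum1_card; apply: eq_bigl => v; rewrite !inE.
apply: subset_leq_card; apply/fintype.subsetP => p /imsetP[x _ ->]; rewrite inE.
case: x => [[F []]|v] /=; try by have [] := fP F.
apply/asboolP => t t0 t1; rewrite negE opprK.
apply: (@midpoint_not_interior [set \val v] 0) => //; first exact: ltnW.
by apply/has_dim0; exists (\val v).
Qed.

End centrally_symmetric_polytope.

(** * An odd trigonometric cubic with two prescribed maxima on the circle *)

Section plane.
Variables (R : realType) (a1 a2 b1 b2 : R).
Hypotheses (a_unit : a1 ^+ 2 + a2 ^+ 2 = 1) (b_unit : b1 ^+ 2 + b2 ^+ 2 = 1).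

Let w1 := a1 + b1.
Let w2 := a2 + b2.
(** The common value of [u = z.w] at [z = a] and [z = b], where [w = a + b]; also half of
    [|w| ^ 2]. *)
Definition plane_h : R := 1 + (a1 * b1 + a2 * b2).
Let h := plane_h.

(* The coefficients of [3 h ^ 2 u - u ^ 3], where [u = z1 w1 + z2 w2], rewritten modulo
   [z1 ^ 2 + z2 ^ 2 = 1] as a combination of [z1], [z2], [z1 ^ 3] and [z2 ^ 3]. *)
Definition lin1 : R := 3 * h ^+ 2 * w1 - 3 * w1 * w2 ^+ 2.
Definition lin2 : R := 3 * h ^+ 2 * w2 - 3 * w1 ^+ 2 * w2.
Definition cub1 : R := 3 * w1 * w2 ^+ 2 - w1 ^+ 3.
Definition cub2 : R := 3 * w1 ^+ 2 * w2 - w2 ^+ 3.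
Definition plane_val (z1 z2 : R) : R :=
  lin1 * z1 + lin2 * z2 + (cub1 * z1 ^+ 3 + cub2 * z2 ^+ 3).

Lemma plane_valE (z1 z2 : R) : z1 ^+ 2 + z2 ^+ 2 = 1 ->
  plane_val z1 z2 = 3 * h ^+ 2 * (z1 * w1 + z2 * w2) - (z1 * w1 + z2 * w2) ^+ 3.
Proof.
move=> z_unit; rewrite /plane_val /lin1 /lin2 /cub1 /cub2.
(* On the circle the mixed cubic monomials reduce to first and third powers of the coordinates. *)
have e1 : z1 ^+ 3 = z1 - z1 * z2 ^+ 2.
  have -> : z1 - z1 * z2 ^+ 2 = z1 * (z1 ^+ 2 + z2 ^+ 2 - z2 ^+ 2) by rewrite z_unit; ring.
  by ring.
have e2 : z2 ^+ 3 = z2 - z1 ^+ 2 * z2.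
  have -> : z2 - z1 ^+ 2 * z2 = z2 * (z1 ^+ 2 + z2 ^+ 2 - z1 ^+ 2) by rewrite z_unit; ring.
  by ring.
have -> : (z1 * w1 + z2 * w2) ^+ 3 = w1 ^+ 3 * z1 ^+ 3 + w2 ^+ 3 * z2 ^+ 3
   + 3 * w1 ^+ 2 * w2 * (z1 ^+ 2 * z2) + 3 * w1 * w2 ^+ 2 * (z1 * z2 ^+ 2) by ring.
by rewrite e1 e2; ring.
Qed.

Lemma plane_w2 : w1 ^+ 2 + w2 ^+ 2 = 2 * h.
Proof.
have -> : w1 ^+ 2 + w2 ^+ 2 =
    (a1 ^+ 2 + a2 ^+ 2) + (b1 ^+ 2 + b2 ^+ 2) + 2 * (a1 * b1 + a2 * b2).
  by rewrite /w1 /w2; ring.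
by rewrite a_unit b_unit /h /plane_h; ring.
Qed.

Lemma plane_aw : a1 * w1 + a2 * w2 = h.
Proof.
have -> : a1 * w1 + a2 * w2 = (a1 ^+ 2 + a2 ^+ 2) + (a1 * b1 + a2 * b2) by rewrite /w1 /w2; ring.
by rewrite a_unit.
Qed.

Lemma plane_bw : b1 * w1 + b2 * w2 = h.
Proof.
have -> : b1 * w1 + b2 * w2 = (b1 ^+ 2 + b2 ^+ 2) + (a1 * b1 + a2 * b2) by rewrite /w1 /w2; ring.
by rewrite b_unit.
Qed.

Lemma plane_val_a : plane_val a1 a2 = 2 * h ^+ 3.
Proof. by rewrite plane_valE // plane_aw; ring. Qed.

Lemma plane_val_b : plane_val b1 b2 = 2 * h ^+ 3.
Proof. by rewrite plane_valE // plane_bw; ring. Qed.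

Hypothesis h_gt : 1 / 2 < h.

(** The gap to the maximum factors as [(u - h) ^ 2 * (u + 2 h)]. Cauchy-Schwarz gives
    [u ^ 2 <= 2 h], and [2 h < 4 h ^ 2] since [h > 1 / 2]; so [u + 2 h > 0]. *)
Lemma plane_val_le (z1 z2 : R) : z1 ^+ 2 + z2 ^+ 2 = 1 ->
  plane_val z1 z2 <= 2 * h ^+ 3 /\
  (plane_val z1 z2 = 2 * h ^+ 3 -> (z1 = a1 /\ z2 = a2) \/ (z1 = b1 /\ z2 = b2)).
Proof.
move=> z_unit; rewrite plane_valE //; set u := z1 * w1 + z2 * w2.
have uh : u ^+ 2 <= 2 * h.
  rewrite -plane_w2 -[leRHS]mul1r -z_unit -subr_ge0 /u.
  have -> : (z1 ^+ 2 + z2 ^+ 2) * (w1 ^+ 2 + w2 ^+ 2) - (z1 * w1 + z2 * w2) ^+ 2 =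
    (z1 * w2 - z2 * w1) ^+ 2 by ring.
  exact: sqr_ge0.
have u2h : 0 < u + 2 * h.
  move: uh h_gt; generalize u h => x y xy y_gt; rewrite ltNge; apply/negP => x_le.
  have : 0 <= (- x - 2 * y) * (2 * y - x) by apply: mulr_ge0; lra.
  have : 0 < y * (2 * y - 1) by apply: mulr_gt0; lra.
  lra.
have E : 2 * h ^+ 3 - (3 * h ^+ 2 * u - u ^+ 3) = (u - h) ^+ 2 * (u + 2 * h) by ring.
split; first by rewrite -subr_ge0 E mulr_ge0 ?sqr_ge0 // ltW.
move=> /eqP; rewrite eq_sym -subr_eq0 E mulf_eq0 (gt_eqF u2h) orbF expf_eq0 /= subr_eq0.
move=> /eqP uE.
(* When [u = h], the vectors [p = z - a] and [q = z - b] are both orthogonal to [w], hence parallel,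
   and also orthogonal to each other; so one of them is 0. *)
pose p1 := z1 - a1; pose p2 := z2 - a2; pose q1 := z1 - b1; pose q2 := z2 - b2.
have pw : p1 * w1 + p2 * w2 = 0.
  have -> : p1 * w1 + p2 * w2 = u - (a1 * w1 + a2 * w2) by rewrite /p1 /p2 /u; ring.
  by rewrite plane_aw uE subrr.
have qw : q1 * w1 + q2 * w2 = 0.
  have -> : q1 * w1 + q2 * w2 = u - (b1 * w1 + b2 * w2) by rewrite /q1 /q2 /u; ring.
  by rewrite plane_bw uE subrr.
have pq : p1 * q1 + p2 * q2 = 0.
  have -> : p1 * q1 + p2 * q2 = (z1 ^+ 2 + z2 ^+ 2) - u + (a1 * b1 + a2 * b2).
    by rewrite /p1 /p2 /q1 /q2 /u /w1 /w2; ring.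
  by rewrite z_unit uE /h /plane_h; ring.
have cpq : p1 * q2 - p2 * q1 = 0.
  have /eqP : (p1 * q2 - p2 * q1) * (w1 ^+ 2 + w2 ^+ 2) = 0.
    have -> : (p1 * q2 - p2 * q1) * (w1 ^+ 2 + w2 ^+ 2) =
      (p1 * w1 + p2 * w2) * (w1 * q2 - w2 * q1) - (q1 * w1 + q2 * w2) * (w1 * p2 - w2 * p1).
      by ring.
    by rewrite pw qw !mul0r subrr.
  rewrite plane_w2 mulf_eq0 => /orP[/eqP //|].
  by rewrite gt_eqF // mulr_gt0 // (lt_trans _ h_gt) // divr_gt0.
have /eqP : (p1 ^+ 2 + p2 ^+ 2) * (q1 ^+ 2 + q2 ^+ 2) = 0.
  have -> : (p1 ^+ 2 + p2 ^+ 2) * (q1 ^+ 2 + q2 ^+ 2) =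
    (p1 * q1 + p2 * q2) ^+ 2 + (p1 * q2 - p2 * q1) ^+ 2 by ring.
  by rewrite pq cpq !expr0n addr0.
rewrite mulf_eq0 => /orP[]; rewrite paddr_eq0 ?sqr_ge0 // !expf_eq0 /= !subr_eq0.
  by move=> /andP[/eqP -> /eqP ->]; left.
by move=> /andP[/eqP -> /eqP ->]; right.
Qed.

(** From [|w1|, |w2| <= 2] and [|h| <= 3], the linear coefficients are at most 78 and the cubic ones
    at most 32 in absolute value. The value is thus at most [2 * (78 + 32) / 1000 < 1 / 4], while
    [2 h ^ 3 >= 1 / 4]. *)
Lemma plane_val_small (z1 z2 : R) : `|z1| <= 1 / 1000 -> `|z2| <= 1 / 1000 ->
  plane_val z1 z2 < 2 * h ^+ 3.
Proof.
move=> z1s z2s.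
have mul (x y c d : R) : `|x| <= c -> `|y| <= d -> `|x * y| <= c * d :> R.
  by move=> xc yd; rewrite normrM ler_pM.
have le1 (x y : R) : x ^+ 2 + y ^+ 2 = 1 -> `|x| <= 1 :> R.
  move=> xy; rewrite -(@ler_pXn2r _ 2) ?nnegrE // real_normK ?num_real // expr1n -xy.
  by rewrite lerDl sqr_ge0.
have u1 := le1 _ _ a_unit; have v1 := le1 _ _ b_unit.
have u2 : `|a2| <= 1 by apply: (le1 _ a1); rewrite addrC.
have v2 : `|b2| <= 1 by apply: (le1 _ b1); rewrite addrC.
have add (x y c d : R) : `|x| <= c -> `|y| <= d -> `|x + y| <= c + d :> R.
  by move=> xc yd; apply: le_trans (ler_normD _ _) _; exact: lerD.
have sub (x y c d : R) : `|x| <= c -> `|y| <= d -> `|x - y| <= c + d :> R.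
  by move=> xc yd; apply: add; rewrite ?normrN.
have n3 : `|3 : R| <= 3 by rewrite ger0_norm.
have n1 : `|1 : R| <= 1 by rewrite normr1.
have nw1 := add _ _ _ _ u1 v1; have nw2 := add _ _ _ _ u2 v2.
have nh := add _ _ _ _ n1 (add _ _ _ _ (mul _ _ _ _ u1 v1) (mul _ _ _ _ u2 v2)).
rewrite -/w1 in nw1; rewrite -/w2 in nw2; rewrite -/plane_h -/h in nh.
have nl1 := sub _ _ _ _ (mul _ _ _ _ (mul _ _ _ _ n3 (mul _ _ _ _ nh nh)) nw1)
  (mul _ _ _ _ (mul _ _ _ _ n3 nw1) (mul _ _ _ _ nw2 nw2)).
have nl2 := sub _ _ _ _ (mul _ _ _ _ (mul _ _ _ _ n3 (mul _ _ _ _ nh nh)) nw2)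
  (mul _ _ _ _ (mul _ _ _ _ n3 (mul _ _ _ _ nw1 nw1)) nw2).
have nc1 := sub _ _ _ _ (mul _ _ _ _ (mul _ _ _ _ n3 nw1) (mul _ _ _ _ nw2 nw2))
  (mul _ _ _ _ nw1 (mul _ _ _ _ nw1 nw1)).
have nc2 := sub _ _ _ _ (mul _ _ _ _ (mul _ _ _ _ n3 (mul _ _ _ _ nw1 nw1)) nw2)
  (mul _ _ _ _ nw2 (mul _ _ _ _ nw2 nw2)).
rewrite -!expr2 -/lin1 in nl1; rewrite -!expr2 -/lin2 in nl2.
rewrite -!expr2 -!exprS -/cub1 in nc1; rewrite -!expr2 -!exprS -/cub2 in nc2.
have cube (z : R) : `|z| <= 1 / 1000 -> `|z ^+ 3| <= 1 / 1000 :> R.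
  move=> zs; rewrite normrX exprS -[leRHS]mulr1 ler_pM // exprn_ile1 //.
  by apply: le_trans zs _; lra.
have := add _ _ _ _ (add _ _ _ _ (mul _ _ _ _ nl1 z1s) (mul _ _ _ _ nl2 z2s))
   (add _ _ _ _ (mul _ _ _ _ nc1 (cube _ z1s)) (mul _ _ _ _ nc2 (cube _ z2s))).
rewrite -/(plane_val z1 z2) => /(le_trans (ler_norm _)) nv.
have h3 : 1 / 4 <= 2 * h ^+ 3.
  have -> : 1 / 4 = 2 * (1 / 2) ^+ 3 :> R by field.
  have h0 : 0 < h by apply: lt_trans h_gt; rewrite divr_gt0.
  by rewrite ler_pM2l // lerXn2r // ?nnegrE ?divr_ge0 // ltW.
by apply: le_lt_trans nv (lt_le_trans _ h3); lra.
Qed.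

End plane.

(** * The cluster points and functionals exposing pairs of them *)

(** The two extreme coefficients are the ones used to show that the cluster points span the
    space. *)
Lemma cubic_roots4 (R : realType) (c0 c1 c2 c3 : R) (r : seq R) : uniq r -> size r = 4%N ->
  (forall y, y \in r -> c0 + c1 * y + c2 * y ^+ 2 + c3 * y ^+ 3 = 0) -> c0 = 0 /\ c3 = 0.
Proof.
move=> ur sr rP.
have p0 : Poly [:: c0; c1; c2; c3] = 0.
  apply: (@roots_geq_poly_eq0 _ _ r) => //; last by rewrite sr (leq_trans (size_Poly _)).
  apply/allP => y ys; rewrite rootE horner_Poly /=; apply/eqP; rewrite -[RHS](rP y ys); ring.
have := congr1 (fun p : {poly R} => p`_0) p0; have := congr1 (fun p : {poly R} => p`_3) p0.
by rewrite !coef_Poly !coef0 /= => -> ->.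
Qed.

Section clusters.
Variables (R : realType) (k N : nat).
Hypotheses (k_ge2 : (1 < k)%N) (N_ge : (4 * k <= N)%N).

Let I := ('I_N * bool)%type.

Lemma k_gt0 : (0 < k)%N. Proof. exact: ltnW. Qed.

(* The index [(p, b)] is the [p]-th point of cluster [p %% k], negated if [b]. *)
Definition cluster (x : I) : 'I_k := Ordinal (ltn_pmod x.1 k_gt0).
Definition sg (x : I) : R := (-1) ^+ x.2.
(** Distinct indices get distinct parameters, all within the range that [plane_val_small] covers. *)
Definition par (x : I) : R := x.1%:R / (1000 * N%:R).
Definition rad (x : I) : R := Num.sqrt (1 - par x ^+ 2).
(** The coordinates off the cluster are all equal, so the cluster coordinate paired with any other
    one gives a point of the unit circle. *)
Definition base (x : I) : 'rV[R]_k :=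
  \row_l (sg x * (if l == cluster x then rad x else par x)).
Definition pt (x : I) : 'rV[R]_(k + k) :=
  row_mx (base x) (\row_l base x ord0 l ^+ 3).

Lemma N_gt0 : (0 < N)%N.
Proof. by apply: leq_trans N_ge; rewrite muln_gt0 k_gt0. Qed.

Lemma par_bound (x : I) : 0 <= par x <= 1 / 1000.
Proof.
have N0 : 0 < N%:R :> R by rewrite ltr0n N_gt0.
have xN : x.1%:R <= N%:R :> R by rewrite ler_nat ltnW.
have D0 : 0 < 1000 * N%:R :> R by lra.
apply/andP; split; first by apply: divr_ge0; [exact: ler0n | exact: ltW].
rewrite ler_pdivrMr //; lra.
Qed.

Lemma par_inj (x y : I) : par x = par y -> x.1 = y.1.
Proof.
have N0 : 0 < N%:R :> R by rewrite ltr0n N_gt0.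
have {}N0 : 1000 * N%:R != 0 :> R by apply: lt0r_neq0; lra.
by rewrite /par => /(mulIf (invr_neq0 N0)) /eqP; rewrite eqr_nat => /eqP /ord_inj.
Qed.

Lemma radE (x : I) : rad x ^+ 2 = 1 - par x ^+ 2.
Proof. by have /andP[? ?] := par_bound x; rewrite sqr_sqrtr //; nra. Qed.

Lemma rad_gt (x : I) : 1 / 2 < rad x.
Proof.
have /andP[? ?] := par_bound x; have r0 : 0 <= rad x by exact: sqrtr_ge0.
by have := radE x; nra.
Qed.

Lemma rad_le1 (x : I) : rad x <= 1.
Proof.
have r0 : 0 <= rad x by exact: sqrtr_ge0.
by have := radE x; have := sqr_ge0 (par x); nra.
Qed.

Lemma sg_cases (x : I) : (x.2 = false /\ sg x = 1) \/ (x.2 = true /\ sg x = -1).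
Proof. by rewrite /sg; case: x.2; [right | left]; rewrite ?expr0 ?expr1. Qed.

Lemma base_cluster (x : I) : base x ord0 (cluster x) = sg x * rad x.
Proof. by rewrite mxE eqxx. Qed.

Lemma base_other (x : I) (l : 'I_k) : l != cluster x -> base x ord0 l = sg x * par x.
Proof. by rewrite mxE => /negPf ->. Qed.

Lemma base_other_small (x : I) (l : 'I_k) : l != cluster x -> `|base x ord0 l| <= 1 / 1000.
Proof.
move=> /base_other ->; have /andP[p0 p1] := par_bound x.
rewrite normrM normr_sign ger0_norm //; lra.
Qed.

Lemma base_unit (x : I) (i j : 'I_k) : i != j -> cluster x = i \/ cluster x = j ->
  base x ord0 i ^+ 2 + base x ord0 j ^+ 2 = 1.
Proof.
have s2 : sg x ^+ 2 = 1 by rewrite /sg sqrr_sign.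
move=> ij [] xE.
  rewrite -{1}xE base_cluster base_other ?xE 1?eq_sym // !(exprMn _ (sg x)) s2 radE. ring.
rewrite -{1}xE base_cluster base_other ?xE // !(exprMn _ (sg x)) s2 radE; ring.
Qed.

(** A coordinate exceeds [1 / 2] in absolute value only if it is that of the cluster, so the two
    values reveal cluster, sign and parameter. *)
Lemma base_eq (x y : I) (i j : 'I_k) : i != j ->
  cluster x = i \/ cluster x = j -> cluster y = i \/ cluster y = j ->
  base x ord0 i = base y ord0 i -> base x ord0 j = base y ord0 j -> x = y.
Proof.
move=> ij xij yij ei ej.
have same l l' : l != l' -> cluster x = l -> cluster y = l ->
    base x ord0 l = base y ord0 l -> base x ord0 l' = base y ord0 l' -> x = y.
  move=> ll' xl yl; rewrite -{1}xl -{1}yl !base_cluster.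
  rewrite !base_other ?xl ?yl 1?eq_sym //.
  have /andP[px0 _] := par_bound x; have /andP[py0 _] := par_bound y.
  have rx := rad_gt x; have ry := rad_gt y.
  move: x y px0 py0 rx ry {xij yij ei ej xl yl} => x y px0 py0 rx ry.
  case: (sg_cases x) (sg_cases y) => -[x2 ->] [] [y2 ->] er ep; try (exfalso; lra).
    have /par_inj e1 : par x = par y by lra.
    by rewrite (surjective_pairing x) (surjective_pairing y) e1 x2 y2.
  have /par_inj e1 : par x = par y by lra.
  by rewrite (surjective_pairing x) (surjective_pairing y) e1 x2 y2.
have diff l (u v : I) : cluster u = l -> l != cluster v ->
    base u ord0 l = base v ord0 l -> False.
  move=> ul vl e; have := base_other_small vl; have ru := rad_gt u.
  rewrite -e -ul base_cluster normrM normr_sign ger0_norm; lra.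
case: xij yij => [xi|xj] [yi|yj].
- exact: (same i j).
- by exfalso; apply: (diff i x y) => //; rewrite yj.
- by exfalso; apply: (diff j x y) => //; rewrite yi eq_sym.
- by apply: (same j i) => //; rewrite eq_sym.
Qed.

Definition compatible (x y : I) := ~~ ((cluster x == cluster y) && (x.2 != y.2)).

(** The inner product of the projections is positive within one cluster and at least [- 1 / 500]
    when the cluster coordinates differ; only antipodal clusters, which [compatible] excludes, bring
    it near -1. *)
Lemma plane_h_gt (x y : I) (i j : 'I_k) : i != j -> compatible x y ->
  cluster x = i -> cluster y = i \/ cluster y = j ->
  1 / 2 < plane_h (base x ord0 i) (base x ord0 j) (base y ord0 i) (base y ord0 j).
Proof.
move=> ij xy xi yij; rewrite /plane_h.
have /andP[px0 px1] := par_bound x; have /andP[py0 py1] := par_bound y.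
have rx := rad_gt x; have ry := rad_gt y.
have rx1 := rad_le1 x; have ry1 := rad_le1 y.
rewrite -{1}xi base_cluster (base_other (l := j)) ?xi 1?eq_sym //.
case: yij => yE.
  rewrite -{1}yE base_cluster (base_other (l := j)) ?yE 1?eq_sym //.
  move: xy; rewrite /compatible xi yE eqxx /= negbK => /eqP sxy.
  have -> : sg x = sg y by rewrite /sg sxy.
  by case: (sg_cases y) => -[_ ->]; nra.
rewrite -{1}yE base_cluster (base_other (l := i)) ?yE //.
by case: (sg_cases x) (sg_cases y) => -[_ ->] [] [_ ->]; nra.
Qed.

Lemma exists_other (i : 'I_k) : exists j, i != j.
Proof.
have [|i0] := eqVneq i (Ordinal k_gt0); last by exists (Ordinal k_gt0).
by move=> ->; exists (Ordinal k_ge2).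
Qed.

(** The functional sees only the coordinates [i] and [j], where it is [plane_val]: clusters [i] and
    [j] project to the unit circle, all others close to the origin. If both points have the same
    cluster coordinate, any second coordinate serves as [j]. *)
Lemma pt_functional (x y : I) : compatible x y -> exists (c : 'rV[R]_(k + k)) (m : R),
  [/\ forall t, dot c (pt t) <= m, dot c (pt x) = m, dot c (pt y) = m &
     forall t, dot c (pt t) = m -> t = x \/ t = y].
Proof.
move=> xy.
have [j [ij yij]] : exists j, cluster x != j /\ (cluster y = cluster x \/ cluster y = j).
  have [<-|ne] := eqVneq (cluster y) (cluster x).
    by have [j ?] := exists_other (cluster y); exists j; split => //; left.
  by exists (cluster y); rewrite eq_sym ne; split => //; right.
pose i := cluster x.
have hgt := plane_h_gt ij xy erefl yij.
pose a1 := base x ord0 i; pose a2 := base x ord0 j.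
pose b1 := base y ord0 i; pose b2 := base y ord0 j.
pose c : 'rV[R]_(k + k) := row_mx
  (lin1 a1 a2 b1 b2 *: delta_mx ord0 i + lin2 a1 a2 b1 b2 *: delta_mx ord0 j)
  (cub1 a1 a2 b1 b2 *: delta_mx ord0 i + cub2 a1 a2 b1 b2 *: delta_mx ord0 j).
have dotE (p q : R) (z : 'I_k -> R) :
    \sum_l (p *: delta_mx ord0 i + q *: delta_mx ord0 j : 'rV[R]_k) ord0 l * z l =
    p * z i + q * z j.
  rewrite (bigD1 i) //= (bigD1 j) /=; last by rewrite eq_sym.
  rewrite big1 => [|l /andP[li lj]]; rewrite !mxE !eqxx ?(negPf ij) ?(negPf li) ?(negPf lj).
    by rewrite (eq_sym j) (negPf ij) /=; ring.
  by rewrite /=; ring.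
have cE t : dot c (pt t) = plane_val a1 a2 b1 b2 (base t ord0 i) (base t ord0 j).
  rewrite /dot big_split_ord /=.
  under eq_bigr do rewrite !row_mxEl.
  under [X in _ + X]eq_bigr do rewrite !row_mxEr [(\row__ _) _ _]mxE.
  by rewrite dotE (dotE _ _ (fun l => base t ord0 l ^+ 3)).
have ua : a1 ^+ 2 + a2 ^+ 2 = 1 by apply: base_unit => //; left.
have ub : b1 ^+ 2 + b2 ^+ 2 = 1 by exact: base_unit.
have unit_or_small t : (cluster t = i \/ cluster t = j) \/
    dot c (pt t) < 2 * plane_h a1 a2 b1 b2 ^+ 3.
  have [/eqP ti|ti] := boolP (cluster t == i); first by left; left.
  have [/eqP tj|tj] := boolP (cluster t == j); first by left; right.
  right; rewrite cE; apply: plane_val_small => //; apply: base_other_small; by rewrite eq_sym.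
exists c, (2 * plane_h a1 a2 b1 b2 ^+ 3); split.
- move=> t; case: (unit_or_small t) => [tij|/ltW//]; rewrite cE.
  by have [] := plane_val_le ua ub hgt (base_unit ij tij).
- by rewrite cE plane_val_a.
- by rewrite cE plane_val_b.
move=> t; case: (unit_or_small t) => [tij|/[swap] ->]; last by rewrite ltxx.
rewrite cE => /(plane_val_le ua ub hgt (base_unit ij tij)).2 [] [e1 e2].
  by left; apply: (base_eq ij) => //; left.
by right; apply: (base_eq ij).
Qed.

Lemma compatible_refl (x : I) : compatible x x.
Proof. by rewrite /compatible !eqxx. Qed.

(** The functional of the pair [(x, x)] is maximal at [x] alone. *)
Lemma pt_inj : injective pt.
Proof.
move=> x y xy; have [c [m [_ cx _ cP]]] := pt_functional (compatible_refl x).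
by have [|->|->] := cP y; rewrite -?xy.
Qed.

Lemma ptN (x : I) : pt (x.1, ~~ x.2) = - pt x.
Proof.
have bN : base (x.1, ~~ x.2) = - base x.
  apply/rowP => l; rewrite !mxE -mulNr; congr (_ * _).
  by rewrite /sg /=; case: x.2; rewrite ?expr0 ?expr1 ?opprK.
apply/rowP => l; case: (splitP l) => j lj.
  have -> : l = lshift k j by apply: val_inj.
  by rewrite [RHS]mxE !row_mxEl bN mxE.
have -> : l = rshift k j by apply: val_inj.
rewrite [RHS]mxE !row_mxEr bN !mxE; ring.
Qed.

End clusters.

(** * The cluster polytope: dimension, vertices and edges *)

Section cluster_polytope.
Variables (R : realType) (k N : nat).
Hypotheses (k_ge2 : (1 < k)%N) (N_ge : (4 * k <= N)%N).

Let I := ('I_N * bool)%type.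
Local Notation pt := (@pt R k N k_ge2).
Local Notation cluster := (@cluster k N k_ge2).
Local Notation compatible := (@compatible k N k_ge2).

Definition cluster_polytope : set 'rV[R]_(k + k) := convex_hull (range pt).
Local Notation P := cluster_polytope.

Lemma finite_range_pt : finite_set (range pt).
Proof. by apply: finite_image; exact: finite_finset. Qed.

Lemma polytope_cluster : polytope P.
Proof. by exists (range pt); first exact: finite_range_pt. Qed.

Lemma range_ptN (v : 'rV[R]_(k + k)) : range pt v -> range pt (- v).
Proof. by move=> [x _ <-]; exists (x.1, ~~ x.2) => //; exact: ptN. Qed.

Lemma cs_cluster : centrally_symmetric P.
Proof.
have symP := convex_hull_sym range_ptN.
apply/seteqP; split=> [x Px|_ [x Px <-]]; last exact: symP.
by exists (- x); [exact: symP | rewrite opprK].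
Qed.

Lemma cluster_polytope_pt (x : I) : P (pt x).
Proof. by apply: sub_convex_hull; exists x. Qed.

Lemma cluster_polytope0 : P 0.
Proof.
pose x : I := (Ordinal (N_gt0 k_ge2 N_ge), true).
have hN : P (- pt x) by apply: convex_hull_sym; [exact: range_ptN | exact: cluster_polytope_pt].
have cP : @convex_set R 'rV[R]_(k + k) P by exact: convex_set_hull.
have := (convex_setE P).1 cP (pt x) (- pt x) 2^-1.
rewrite scalerN; have -> : 1 - 2^-1 = 2^-1 :> R by lra.
by rewrite subrr; apply; [lra | lra | exact: cluster_polytope_pt | exact: hN].
Qed.

(** On the positive points of cluster [i], with [r] for [rad] and [s] for [par], the relation reads
    [a r + b r ^ 3 = - (X s + Y s ^ 3)]. Squaring it and using [r ^ 2 = 1 - s ^ 2] gives a cubic in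
    [s ^ 2] with constant coefficient [(a + b) ^ 2] and leading coefficient [- b ^ 2 - Y ^ 2]; four
    roots make both vanish. *)
Lemma dot_pt_eq0 (v : 'rV[R]_(k + k)) : (forall x, dot v (pt x) = 0) -> v = 0.
Proof.
move=> v0.
have coords i : v ord0 (lshift k i) = 0 /\ v ord0 (rshift k i) = 0.
  pose X := \sum_(l < k | l != i) v ord0 (lshift k l).
  pose Y := \sum_(l < k | l != i) v ord0 (rshift k l).
  set a := v ord0 (lshift k i); set b := v ord0 (rshift k i).
  have eqn (x : I) : x.2 = false -> cluster x = i ->
      a * rad R x + b * rad R x ^+ 3 = - (X * par R x + Y * par R x ^+ 3).
    move=> x2 xi; have s1 : sg R x = 1 by rewrite /sg x2.
    have zi : base R k_ge2 x ord0 i = rad R x by rewrite -xi base_cluster s1 mul1r.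
    have zl l : l != i -> base R k_ge2 x ord0 l = par R x.
      by move=> li; rewrite base_other ?xi // s1 mul1r.
    have := v0 x; rewrite /dot big_split_ord /=.
    under eq_bigr do rewrite row_mxEl.
    under [X in _ + X]eq_bigr do rewrite row_mxEr [(\row__ _) _ _]mxE.
    rewrite (bigD1 i) //= [X in _ + X](bigD1 i) //= zi.
    under eq_bigr => l li do rewrite zl //.
    under [X in _ + (_ + X)]eq_bigr => l li do rewrite zl //.
    rewrite -!mulr_suml -/X -/Y -/a -/b => e.
    by apply/eqP; rewrite -subr_eq0 opprK -[X in _ == X]e; apply/eqP; ring.
  (* The hypothesis [4 * k <= N] provides four indices in each residue class. *)
  have idx (j : 'I_4) : (i + j * k < N)%N.
    apply: leq_trans N_ge; have := ltn_ord i; have := ltn_ord j; nia.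
  pose x (j : 'I_4) : I := (Ordinal (idx j), false).
  have xi j : cluster (x j) = i.
    by apply: val_inj; rewrite /= addnC modnMDl modn_small.
  pose r := [seq par R (x j) ^+ 2 | j <- enum 'I_4].
  have ur : uniq r.
    rewrite map_inj_uniq ?enum_uniq // => j j' /eqP.
    have /andP[p0 _] := par_bound R k_ge2 N_ge (x j).
    have /andP[p0' _] := par_bound R k_ge2 N_ge (x j').
    rewrite eqrXn2 // => /eqP /(par_inj k_ge2 N_ge) /(congr1 (@nat_of_ord N)) /= /eqP.
    by rewrite eqn_add2l eqn_pmul2r ?(k_gt0 k_ge2) // => /eqP /ord_inj.
  have sr : size r = 4%N by rewrite size_map size_enum_ord.
  have [|c0 c3] := @cubic_roots4 R ((a + b) ^+ 2)
    (- 2 * (a + b) * b - (a + b) ^+ 2 - X ^+ 2)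
    (b ^+ 2 + 2 * (a + b) * b - 2 * X * Y) (- b ^+ 2 - Y ^+ 2) r ur sr.
    move=> _ /mapP[j _ ->]; have := eqn (x j) erefl (xi j).
    have := radE R k_ge2 N_ge (x j); set q := rad R _; set s := par R _ => qs.
    move=> /(congr1 (fun y => y ^+ 2)).
    have -> : (a * q + b * q ^+ 3) ^+ 2 = q ^+ 2 * (a + b * q ^+ 2) ^+ 2 by ring.
    rewrite qs => /eqP; rewrite -subr_eq0 => /eqP <-; ring.
  have b0 : b = 0.
    have b2 := sqr_ge0 b; have Y2 := sqr_ge0 Y.
    by apply/eqP; rewrite -sqrf_eq0 eq_le b2 andbT; lra.
  split => //; move/eqP: c0; rewrite b0 addr0 sqrf_eq0 => /eqP //.
apply/rowP => l; rewrite mxE; case: (splitP l) => j lj.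
  have -> : l = lshift k j by apply: val_inj.
  by have [] := coords j.
have -> : l = rshift k j by apply: val_inj.
by have [] := coords j.
Qed.

Lemma has_dim_cluster : has_dim P (k + k).
Proof.
apply/has_dim_full/seteqP; split => // y _.
pose M := \matrix_(i < #|{: I}|) pt (enum_val i).
have fullM : row_full M.
  rewrite /row_full -mxrank_tr -[_ == _]/(row_free M^T) -kermx_eq0.
  apply/rowV0P => v /sub_kermxP vM; apply: dot_pt_eq0 => x.
  have := congr1 (fun A : 'rV_ _ => A ord0 (enum_rank x)) vM; rewrite !mxE => vx.
  rewrite -[RHS]vx; apply: eq_bigr => l _.
  by rewrite !mxE enum_rankK.
have [D ->] : exists D, y = D *m M by apply/submxP; exact: submx_full.
(* A linear combination of the points becomes affine by giving the remaining weight to the origin,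
   which lies in [P]. *)
pose w (i : 'I_(#|{: I}|).+1) := if unlift ord0 i is Some j then D ord0 j else 1 - \sum_j D ord0 j.
pose p (i : 'I_(#|{: I}|).+1) := if unlift ord0 i is Some j then pt (enum_val j) else 0.
exists (#|{: I}|).+1, p, w; split.
- by move=> i; rewrite /p; case: unliftP => [j _|_];
    [exact: cluster_polytope_pt | exact: cluster_polytope0].
- rewrite big_ord_recl /w unlift_none.
  by under [X in _ + X]eq_bigr do rewrite liftK; rewrite subrK.
- rewrite big_ord_recl /w /p unlift_none scaler0 add0r mulmx_sum_row.
  by apply: eq_bigr => i _; rewrite liftK rowK.
Qed.

Lemma face_pt (x : I) : face P [set pt x].
Proof.
have [c [m [cm cx _ cP]]] := pt_functional R N_ge (compatible_refl k_ge2 x).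
have -> : [set pt x] = convex_hull (range pt `&` [set v | dot c v = m]).
  rewrite -convex_hull1; congr convex_hull; apply/seteqP; split=> [_ ->|_ [[t _ <-] /= tm]].
    by split => //; exists x.
  by have [->|->] := cP t tm.
by apply: face_convex_hull => _ [t _ <-].
Qed.

Lemma num_vertices_cluster : num_faces P 0 = (2 * N)%N.
Proof.
rewrite num_faces0; last exact: polytope_cluster.
have -> : [set v | face P [set v]] = range pt.
  apply/seteqP; split=> [v /= /faceE[c [m [_ _ vE]]]|_ [x _ <-]]; last exact: face_pt.
  (* A vertex is the hull of the generators on its hyperplane, hence one of them. *)
  have [A0|/set0P[u [Au cu]]] := eqVneq (range pt `&` [set x | dot c x = m]) set0.
    by have /seteqP[/(_ v erefl)] := vE; rewrite A0 convex_hull0.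
  suff : [set v] u by move=> <-.
  by rewrite vE; apply: sub_convex_hull.
rewrite fset_set_image; last exact: finite_finset.
rewrite card_imfset; last exact: pt_inj.
rewrite -(card_uniqP (fset_uniq _)) (_ : #|_| = #|{: I}|).
  by rewrite card_prod card_ord card_bool mulnC.
by apply: eq_card => x; rewrite in_fset_set; [exact: mem_set | exact: finite_finset].
Qed.

Lemma face_segment_pt (x y : I) : compatible x y ->
  face P (convex_hull [set pt x; pt y]) /\
  forall t, convex_hull [set pt x; pt y] (pt t) -> t = x \/ t = y.
Proof.
move=> xy; have [c [m [cm cx cy cP]]] := pt_functional R N_ge xy.
have E : [set pt x; pt y] = range pt `&` [set v | dot c v = m].
  apply/seteqP; split=> [_ [->|->]|_ [[t _ <-] /= tm]].
  - by split => //; exists x.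
  - by split => //; exists y.
  - by have [->|->] := cP t tm; [left | right].
have cA v : range pt v -> dot c v <= m by move=> [t _ <-].
rewrite E; split; first exact: face_convex_hull.
by move=> t; rewrite -convex_hull_face // => -[_ /cP].
Qed.

(** Of the [(2 N) ^ 2] ordered pairs of indices, at most [2 N] are diagonal ([T]) and at most
    [2 N (N / k + 1)] lie in antipodal clusters ([S], enlarged by the case analysis on signs). The
    rest ([D]) give edges, each at most twice; halving yields the bound. *)
Lemma num_edges_cluster :
  (2 * N ^ 2 <= num_faces P 1 + N + N * (N %/ k).+1)%N.
Proof.
rewrite /num_faces; set E := fset_set _.
pose D := [set p : I * I | (p.1 != p.2) && compatible p.1 p.2]%SET.
pose S := [set p : I * I | (cluster p.1 == cluster p.2) && (p.1.2 != p.2.2)]%SET.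
pose T := [set p : I * I | p.1 == p.2]%SET.
have cT : (#|T| <= N * 2)%N.
  rewrite -[X in (_ <= X * 2)%N]card_ord -card_bool -card_prod.
  rewrite -(@card_in_imset _ _ fst T); first exact: max_card.
  by move=> [a b] [a' b']; rewrite !inE /= => /eqP <- /eqP <- ->.
have cS : (#|S| <= N * 2 * (N %/ k).+1)%N.
  rewrite -[X in (X * 2 * _)%N]card_ord -card_bool -[X in (_ * X)%N]card_ord -!card_prod.
  (* Given [x], a point of the antipodal cluster is determined by the quotient of its index by
     [k]. *)
  pose f (p : I * I) : 'I_N * bool * 'I_(N %/ k).+1 := (p.1, inord (p.2.1 %/ k)).
  rewrite -(@card_in_imset _ _ f S); first exact: max_card.
  move=> [x y] [x' y']; rewrite !inE /f /=.
  move=> /andP[/eqP xy sxy] /andP[/eqP xy' sxy'] [xx' /(congr1 (@nat_of_ord _))].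
  rewrite !inordK ?ltnS ?leq_div2r 1?ltnW // => yd.
  rewrite -xx' in xy' sxy' *; congr (_, _).
  rewrite (surjective_pairing y) (surjective_pairing y'); congr (_, _).
    apply: ord_inj; rewrite (divn_eq y.1 k) (divn_eq y'.1 k) yd.
    by have := etrans (esym xy) xy' => /(congr1 val) /= ->.
  by move: sxy sxy'; case: x.2; case: y.2; case: y'.2.
have cI : #|{: I}| = (N * 2)%N by rewrite card_prod card_ord card_bool.
have cD : (#|{: I * I}| <= #|D| + (#|T| + #|S|))%N.
  rewrite -(cardsC D) leq_add2l; apply: leq_trans (leq_card_setU _ _).
  apply: subset_leq_card; apply/fintype.subsetP => p; rewrite !inE negb_and negbK /compatible negbK.
  by [].
have finE : finite_set [set F | face P F /\ has_dim F 1].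
  by apply: finite_faces; exact: polytope_cluster.
have edge (p : {p | p \in D}) : convex_hull [set pt (\val p).1; pt (\val p).2] \in E.
  rewrite in_fset_set // inE; have := valP p; rewrite inE => /andP[ne comp]; split.
    by have [] := face_segment_pt comp.
  by apply: has_dim_segment; rewrite (inj_eq (pt_inj N_ge)).
(* The edge gives the unordered pair, the boolean its order. *)
pose g (p : {p | p \in D}) : E * bool :=
  ([` edge p]%fset, (enum_rank (\val p).1 < enum_rank (\val p).2)%N).
have g_inj : injective g.
  move=> p q [] /(congr1 (fun F : set _ => F)) hpq opq; apply: val_inj.
  have := valP p; have := valP q; rewrite !inE => /andP[nq cq] /andP[np cp].
  have [_ Hq] := face_segment_pt cq.
  have hp t : t = (\val p).1 \/ t = (\val p).2 -> t = (\val q).1 \/ t = (\val q).2.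
    move=> tp; apply: Hq; rewrite -hpq; apply: sub_convex_hull.
    by case: tp => ->; [left | right].
  have h1 := hp _ (or_introl erefl); have h2 := hp _ (or_intror erefl).
  have {}opq : (enum_rank (\val p).1 < enum_rank (\val p).2)%N =
    (enum_rank (\val q).1 < enum_rank (\val q).2)%N by exact: opq.
  case: (\val p) (\val q) np nq h1 h2 opq {hpq cp cq Hq hp} => [a b] [a' b'] /= np nq h1 h2 opq.
  case: h1 h2 => -> [] -> in np opq *; rewrite ?eqxx // in np *.
  exfalso; move: opq; case: (ltngtP (enum_rank a') (enum_rank b')) => // /ord_inj /enum_rank_inj e.
  by rewrite e eqxx in nq.
have := leq_card g g_inj; rewrite card_sig card_prod card_bool -cardfE.
rewrite -[#|(fun _ => _)|]/#|D| => DE.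
rewrite card_prod cI in cD.
move: cD DE cT cS; rewrite -mulnn; set q := (N %/ k).+1; nia.
Qed.

End cluster_polytope.

(** * The two bounds for [fmax] and their assembly *)

Lemma fmaxP (R : realType) (d n j : nat) : fmax R d n j = 0%N \/
  exists2 P : set 'rV[R]_d, cs_polytope n P & num_faces P j = fmax R d n j.
Proof.
rewrite /fmax; case: xgetP => [m _ [[P Pn <-] _]|_]; last by left.
by right; exists P.
Qed.

(** The uniform bound [b] ensures that the set of counts has a maximum, so that [fmax] is not the
    default value. *)
Lemma fmax_ge (R : realType) (d n j b : nat) (P : set 'rV[R]_d) :
  (forall Q : set 'rV[R]_d, cs_polytope n Q -> (num_faces Q j <= b)%N) ->
  cs_polytope n P -> (num_faces P j <= fmax R d n j)%N.
Proof.
move=> Qb Pn; pose counts := [set num_faces Q j | Q in @cs_polytope R d n].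
have exc : exists m, `[< counts m >] by exists (num_faces P j); apply/asboolP; exists P.
have ubc m : `[< counts m >] -> (m <= b)%N by move=> /asboolP[Q Qn <-]; exact: Qb.
have [m /asboolP cm mmax] := ex_maxnP exc ubc.
have top : (counts `&` ubound counts) m.
  by split => // q cq; rewrite leEnat; apply: mmax; apply/asboolP.
rewrite /fmax; case: xgetP => [q _ [_]|/(_ m)//].
by move=> /(_ (num_faces P j)); rewrite leEnat; apply; exists P.
Qed.

Lemma cs_edges_bound (R : realType) (d n : nat) (P : set 'rV[R]_d) : (1 < d)%N ->
  cs_polytope n P -> (2 ^ d * (2 * num_faces P 1 + n) <= (2 ^ d).-1 * n ^ 2)%N.
Proof. by move=> d_gt1 [polP csP dimP nP]; exact: edges_bound. Qed.

Lemma double_bin2 (n : nat) : ('C(n, 2) * 2 = n * n.-1)%N.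
Proof. by have := bin_ffact n 2; rewrite ffactnS ffactn1. Qed.

(** Holds without error term: the summand [n] in the edge bound turns [n ^ 2] into [n (n - 1)]. *)
Lemma fmax_upper (R : realType) (d n : nat) : (1 < d)%N ->
  (fmax R d n 1)%:R / 'C(n, 2)%:R <= 1 - 1 / 2 ^+ d :> R.
Proof.
move=> d_gt1; have q1 : 1 <= 2 ^+ d :> R by rewrite exprn_ege1 // ler1n.
have q0 : 0 < 2 ^+ d :> R by lra.
have r0 : 0 <= 1 - 1 / 2 ^+ d :> R by rewrite subr_ge0 ler_pdivrMr // mul1r.
(* For [n < 2] the quotient is 0, by the convention on division by 0. *)
case: (posnP 'C(n, 2)) => [->|C0]; first by rewrite invr0 mulr0.
case: (fmaxP R d n 1) => [->|[P Pn <-]]; first by rewrite mul0r.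
have C0' : 0 < 'C(n, 2)%:R :> R by rewrite ltr0n.
have := cs_edges_bound d_gt1 Pn; set E := num_faces P 1 => Eb.
have nn : 'C(n, 2)%:R * 2 = n%:R * (n%:R - 1) :> R.
  rewrite -natrM double_bin2 natrM -subn1 natrB //.
  by rewrite lt0n; apply: contraTneq C0 => ->.
have q_pred : (2 ^ d).-1%:R = 2 ^+ d - 1 :> R by rewrite -subn1 natrB ?expn_gt0 // natrX.
have {}Eb : 2 ^+ d * (2 * E%:R + n%:R) <= (2 ^+ d - 1) * n%:R ^+ 2 :> R.
  by rewrite -q_pred -!natrX -natrM -natrD -!natrM ler_nat.
rewrite ler_pdivrMr // -(ler_pM2l q0).
have -> : 2 ^+ d * ((1 - 1 / 2 ^+ d) * 'C(n, 2)%:R) = (2 ^+ d - 1) * 'C(n, 2)%:R :> R.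
  by field; rewrite gt_eqF.
by have := ler0n R n; nra.
Qed.

(** With [K = 2 k - 1] and [t = N / k] rounded down, there are at least [2 N ^ 2 - N - N (t + 1)]
    edges, and [K (t + 1) <= 2 N - 1] makes this at least [(1 - 1 / K) N (2 N - 1)]. *)
Lemma fmax_lower (R : realType) (k N : nat) : (1 < k)%N -> (2 * k ^ 2 <= N)%N ->
  1 - 1 / ((k + k)%:R - 1) <= (fmax R (k + k) (2 * N) 1)%:R / 'C(2 * N, 2)%:R :> R.
Proof.
move=> k_ge2 N_ge; have N_ge4 : (4 * k <= N)%N by nia.
have Pn : cs_polytope (2 * N) (@cluster_polytope R k N k_ge2 : set 'rV[R]_(k + k)).
  split; [exact: polytope_cluster | exact: cs_cluster | exact: has_dim_cluster |].
  exact: num_vertices_cluster.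
have d_gt1 : (1 < k + k)%N by lia.
have : (num_faces (@cluster_polytope R k N k_ge2) 1 <= fmax R (k + k) (2 * N) 1)%N.
  apply: (@fmax_ge R _ _ _ ((2 * N) ^ 2)) Pn => Q /(cs_edges_bound d_gt1) Qb.
  have q0 : (0 < 2 ^ (k + k))%N by rewrite expn_gt0.
  suff : (2 * num_faces Q 1 + 2 * N <= (2 * N) ^ 2)%N by lia.
  rewrite -(leq_pmul2l q0); apply: leq_trans Qb _.
  by rewrite leq_mul2r leq_pred orbT.
have := num_edges_cluster R k_ge2 N_ge4.
set E := num_faces _ 1; set F := fmax _ _ _ _; set t := (N %/ k)%N => Elow EF.
have t_ge : (2 * k <= t)%N by rewrite leq_divRL ?(ltnW k_ge2) // -mulnA mulnn.
have kt : (t * k <= N)%N by exact: leq_trunc_div.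
(* The left side is [2 k t + 2 k - t], where [t >= 2 k] comes from [2 * k ^ 2 <= N]. *)
have tk : ((2 * k - 1) * t.+1 + 1 <= 2 * N)%N by nia.
have {Elow EF} FE : (2 * N ^ 2 <= F + N + N * t.+1)%N by lia.
have N0 : (0 < N)%N by lia.
have K0 : 0 < (k + k)%:R - 1 :> R by rewrite subr_gt0 ltr1n.
have C2 : 'C(2 * N, 2)%:R = N%:R * (2 * N%:R - 1) :> R.
  have : ('C(2 * N, 2) = N * (2 * N - 1))%N.
    by apply/eqP; rewrite -(eqn_pmul2r (isT : (0 < 2)%N)) double_bin2 -subn1; apply/eqP; lia.
  by move=> ->; rewrite natrM natrB ?natrM //; lia.
have C0 : 0 < 'C(2 * N, 2)%:R :> R by rewrite ltr0n bin_gt0; lia.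
have {}tk : ((k + k)%:R - 1) * (t.+1)%:R + 1 <= 2 * N%:R :> R.
  have -> : (k + k)%:R - 1 = (2 * k - 1)%:R :> R by rewrite natrB ?mul2n ?addnn //; lia.
  by rewrite -!natrM natr1 ler_nat -addn1.
have {}FE : 2 * N%:R ^+ 2 <= F%:R + N%:R + N%:R * (t.+1)%:R :> R.
  by rewrite -natrX -!natrM -!natrD ler_nat.
rewrite ler_pdivlMr // -(ler_pM2l K0) C2.
have scaleE (K y : R) : 0 < K -> K * ((1 - 1 / K) * y) = (K - 1) * y.
  by move=> K_gt0; field; rewrite gt_eqF.
have N0' : 0 < N%:R :> R by rewrite ltr0n.
rewrite scaleE //.
move: K0 tk FE N0'; move: (_ - 1) (t.+1%:R) (N%:R) (F%:R) => K T x f K0 tk FE x0.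
have : 0 <= K * (f + x + x * T - 2 * x ^+ 2) by apply: mulr_ge0; lra.
have : 0 <= x * (2 * x - (K * T + 1)) by apply: mulr_ge0; lra.
lra.
Qed.

Theorem theorem1p3 (R : realType) (d : nat) (d_gt0 : (0 < d)%N)
    (d_even : ~~ odd d) :
  exists e1 e2 : nat -> R,
    [/\ e1 @ \oo --> (0 : R), e2 @ \oo --> (0 : R) &
      forall n : nat, (exists P : set 'rV[R]_d, cs_polytope n P) ->
        1 - 1 / (d%:R - 1) + e1 n <= (fmax R d n 1)%:R / 'C(n, 2)%:R
        /\ (fmax R d n 1)%:R / 'C(n, 2)%:R <= 1 - 1 / 2 ^+ d + e2 n].
Proof.
have d_gt1 : (1 < d)%N by case: d d_gt0 d_even => [|[|]].
(* For [n = 2 N] and [d = 2 k], the condition [2 * k ^ 2 <= N] is [d ^ 2 <= n]. Below this threshold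
   the error -1 makes the lower bound negative. *)
exists (fun n => if (n < d ^ 2)%N then -1 else 0), (fun=> 0); split.
- apply: cvg_near_cst; exists (d ^ 2)%N => // n /= dn.
  by rewrite ltnNge dn.
- exact: cvg_cst.
move=> n [P [polP csP dimP nP]]; rewrite addr0; split; last exact: fmax_upper.
have F0 : 0 <= (fmax R d n 1)%:R / 'C(n, 2)%:R :> R by rewrite divr_ge0.
have d0 : 0 < d%:R - 1 :> R by rewrite subr_gt0 ltr1n.
case: ltnP => [_|dn]; first by apply: le_trans F0; have := divr_gt0 ltr01 d0; lra.
rewrite addr0.
have n_even : ~~ odd n by rewrite -nP; exact: even_vertices.
pose k := d./2; have dE : d = (k + k)%N by rewrite addnn -(odd_double_half d) (negPf d_even).
have nE : n = (2 * n./2)%N by rewrite mul2n -{1}(odd_double_half n) (negPf n_even).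
have [k_gt1|k_le1] := ltnP 1 k.
  rewrite nE dE; apply: fmax_lower => //.
  by move: dn; rewrite {1}nE dE; nia.
(* The clusters require two coordinates, so [k = 1] is separate; there the lower bound is 0. *)
have d2 : d = 2%N by apply/eqP; rewrite eqn_leq d_gt1 andbT dE addnn -[2%N]/(1.*2)%N leq_double.
by apply: le_trans F0; rewrite d2 (_ : 2 - 1 = 1 :> R) ?divr1 ?subrr //; ring.
Qed.
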